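(* There is a constant $c$ such that for every $f\in L^1(W^T_\kappa;T^d)$ and every $x\in T^d$, $\mathcal M^T_\kappa f(x)\le c\,M^T_\kappa f(x)$.
   Context: $T^d=\{x\in\mathbb R^d:x_i\ge0,\ |x|:=x_1+\dots+x_d\le1\}$, $B^d$ the unit ball of $\mathbb R^d$, $\psi(x)=(x_1^2,\dots,x_d^2)$ mapping $B^d$ onto $T^d$. $\kappa=(\kappa_1,\dots,\kappa_{d+1})$, $\kappa_i\ge0$; $W^T_\kappa(x)=\prod_{i=1}^dx_i^{\kappa_i-1/2}(1-|x|)^{\kappa_{d+1}-1/2}$ on $T^d$; $W^B_\kappa(x)=\prod_{i=1}^d|x_i|^{2\kappa_i}(1-\|x\|^2)^{\kappa_{d+1}-1/2}$ on $B^d$. $V_\kappa g(z)=c_\kappa\int_{[-1,1]^{d+1}}g(z_1t_1,\dots,z_{d+1}t_{d+1})\prod_{i=1}^{d+1}(1+t_i)(1-t_i^2)^{\kappa_i-1}dt$ on functions on $\mathbb R^{d+1}$, $V_\kappa1=1$ (factors with $\kappa_i=0$ via the limit $\frac12[g(1)+g(-1)]$); $V^B_\kappa g(x,x_{d+1})=\frac12[V_\kappa g(x,x_{d+1})+V_\kappa g(x,-x_{d+1})]$; $e(x,\theta)=\{(y,y_{d+1}):\|(y,y_{d+1})\|\le1,\ \langle x,y\rangle+\sqrt{1-\|x\|^2}y_{d+1}\ge\cos\theta,\ y_{d+1}\ge0\}$; $Y=(y,\sqrt{1-\|y\|^2})$; $\mathcal M^B_\kappa g(x)=\sup_{0<\theta\le\pi}\frac{\int_{B^d}|g(y)|V^B_\kappa[\chi_{e(x,\theta)}](Y)W^B_\kappa(y)dy}{\int_{B^d}V^B_\kappa[\chi_{e(x,\theta)}](Y)W^B_\kappa(y)dy}$.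 $\mathcal M^T_\kappa$ is characterized by $(\mathcal M^T_\kappa f)\circ\psi=\mathcal M^B_\kappa(f\circ\psi)$. With $d_T(x,y)=\arccos\big(\sum_{i=1}^d\sqrt{x_iy_i}+\sqrt{1-|x|}\sqrt{1-|y|}\big)$, $M^T_\kappa f(x)=\sup_{0<\theta\le\pi}\frac{\int_{d_T(x,y)\le\theta}|f(y)|W^T_\kappa(y)dy}{\int_{d_T(x,y)\le\theta}W^T_\kappa(y)dy}$. *)

(* Defs.v *)
From HB Require Import structures.
From mathcomp Require Import all_boot all_order all_algebra.
From mathcomp Require Import all_classical all_reals all_analysis.
Set Implicit Arguments. Unset Strict Implicit. Unset Printing Implicit Defensive.
Import Order.TTheory GRing.Theory Num.Theory.
Import numFieldNormedType.Exports.
Local Open Scope classical_set_scope.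
Local Open Scope ring_scope.

Section Defs.
Variable R : realType.

Definition upd n (x : 'I_n -> R) (i : 'I_n) (t : R) : 'I_n -> R :=
  fun j => if j == i then t else x j.

(* Apply one-dimensional (Lebesgue-type) operators coordinatewise, i.e.
   an iterated integral: ops i acts on the i-th variable. *)
Definition iter_op n (ops : 'I_n -> (R -> \bar R) -> \bar R)
  (g : ('I_n -> R) -> \bar R) : \bar R :=
  foldr (fun i G => fun s => ops i (fun t => G (upd s i t))) g (enum 'I_n)
    (fun _ => 0).

(* Lebesgue integral over R^n (iterated, Tonelli) of a nonnegative function *)
Definition intd n (g : ('I_n -> R) -> \bar R) : \bar R :=
  iter_op (fun _ h => (\int[@lebesgue_measure R]_t h t)%E) g.

Definition measurable_n n : set (set ('I_n -> R)) :=
  <<s [set A | exists i : 'I_n, exists2 B : set R, measurable B &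
               A = (fun x => x i) @^-1` B] >>.

Definition absv n (x : 'I_n -> R) : R := \sum_i x i.
Definition norm2 n (x : 'I_n -> R) : R := \sum_i x i ^+ 2.

Definition Tsimplex d : set ('I_d -> R) :=
  [set x | (forall i, 0 <= x i) /\ absv x <= 1].
Definition Bball d : set ('I_d -> R) := [set x | norm2 x <= 1].

Definition psi d (x : 'I_d -> R) : 'I_d -> R := fun i => x i ^+ 2.

(* kappa = (kappa_1, ..., kappa_{d+1}) : 'I_d.+1 -> R ; kappa_i for i : 'I_d is
   kappa (lift ord_max i), kappa_{d+1} is kappa ord_max *)
Definition WT d (kappa : 'I_d.+1 -> R) (x : 'I_d -> R) : R :=
  (\prod_i powR (x i) (kappa (lift ord_max i) - 2^-1)) *
  powR (1 - absv x) (kappa ord_max - 2^-1).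

Definition WB d (kappa : 'I_d.+1 -> R) (x : 'I_d -> R) : R :=
  (\prod_i powR `|x i| (2 * kappa (lift ord_max i))) *
  powR (1 - norm2 x) (kappa ord_max - 2^-1).

Definition Vweight (k : R) (t : R) : R := (1 + t) * powR (1 - t ^+ 2) (k - 1).
Definition Vconst (k : R) : R :=
  (fine (\int[@lebesgue_measure R]_(t in `[(-1)%R, 1%R]) (Vweight k t)%:E)%E)^-1.
Definition Vop1 (k : R) (h : R -> \bar R) : \bar R :=
  if k == 0 then ((h 1%R + h (-1)%R) * (2^-1)%:E)%E
  else ((Vconst k)%:E * \int[@lebesgue_measure R]_(t in `[(-1)%R, 1%R])
          (h t * (Vweight k t)%:E))%E.

Definition Vk n (kappa : 'I_n -> R) (g : ('I_n -> R) -> \bar R) (z : 'I_n -> R)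
  : \bar R :=
  iter_op (fun i h => Vop1 (kappa i) (fun t => h (z i * t))) g.

Definition ext d (y : 'I_d -> R) (s : R) : 'I_d.+1 -> R :=
  fun j => if @unlift d.+1 ord_max j is Some i then y i else s.
Definition fst_d d (w : 'I_d.+1 -> R) : 'I_d -> R := fun i => w (lift ord_max i).
Definition lst_d d (w : 'I_d.+1 -> R) : R := w ord_max.

Definition VBk d (kappa : 'I_d.+1 -> R) (g : ('I_d.+1 -> R) -> \bar R)
  (w : 'I_d.+1 -> R) : \bar R :=
  ((Vk kappa g w + Vk kappa g (ext (fst_d w) (- lst_d w))) * (2^-1)%:E)%E.

Definition inner d (x y : 'I_d -> R) : R := \sum_i x i * y i.

Definition ecap d (x : 'I_d -> R) (theta : R) : set ('I_d.+1 -> R) :=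
  [set w | norm2 w <= 1 /\
           inner x (fst_d w) + Num.sqrt (1 - norm2 x) * lst_d w >= cos theta /\
           lst_d w >= 0].

Definition Yof d (y : 'I_d -> R) : 'I_d.+1 -> R := ext y (Num.sqrt (1 - norm2 y)).

(* ratio of a (possibly infinite) numerator and a finite positive denominator *)
Definition eratio (a b : \bar R) : \bar R := (a * ((fine b)^-1)%:E)%E.

Definition calMB d (kappa : 'I_d.+1 -> R) (g : ('I_d -> R) -> R) (x : 'I_d -> R)
  : \bar R :=
  ereal_sup [set r | exists2 theta : R, 0 < theta <= pi &
    r = eratio
      (intd (fun y => ((\1_(@Bball d) y)%:E * (`|g y|)%:E *
          VBk kappa (fun w => (\1_(ecap x theta) w)%:E) (Yof y) *
          (WB kappa y)%:E)%E))
      (intd (fun y => ((\1_(@Bball d) y)%:E *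
          VBk kappa (fun w => (\1_(ecap x theta) w)%:E) (Yof y) *
          (WB kappa y)%:E)%E))].

(* (calMT f) o psi = calMB (f o psi); we evaluate at the preimage (sqrt x_i) *)
Definition calMT d (kappa : 'I_d.+1 -> R) (f : ('I_d -> R) -> R) (x : 'I_d -> R)
  : \bar R :=
  calMB kappa (f \o @psi d) (fun i => Num.sqrt (x i)).

Definition dT d (x y : 'I_d -> R) : R :=
  acos (\sum_i Num.sqrt (x i * y i) +
        Num.sqrt (1 - absv x) * Num.sqrt (1 - absv y)).

Definition MT d (kappa : 'I_d.+1 -> R) (f : ('I_d -> R) -> R) (x : 'I_d -> R)
  : \bar R :=
  ereal_sup [set r | exists2 theta : R, 0 < theta <= pi &
    r = eratio
      (intd (fun y =>
         ((\1_(@Tsimplex d `&` [set y | dT x y <= theta]) y)%:E *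
          (`|f y| * WT kappa y)%:E)%E))
      (intd (fun y =>
         ((\1_(@Tsimplex d `&` [set y | dT x y <= theta]) y)%:E *
          (WT kappa y)%:E)%E))].

Definition L1T d (kappa : 'I_d.+1 -> R) (f : ('I_d -> R) -> R) : Prop :=
  (forall B : set R, measurable B ->
     measurable_n (@Tsimplex d `&` f @^-1` B)) /\
  (intd (fun y => ((\1_(@Tsimplex d) y)%:E * (`|f y| * WT kappa y)%:E)%E)
     < +oo)%E.

End Defs.
Arguments Tsimplex {R} d.
Arguments Bball {R} d.

(* Main.v *)
Require Import Defs.
From HB Require Import structures.
From mathcomp Require Import all_boot all_order all_algebra.
From mathcomp Require Import all_classical all_reals all_analysis.
From mathcomp Require Import measurable_realfun ring lra.
Set Implicit Arguments. Unset Strict Implicit. Unset Printing Implicit Defensive.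
Import Order.TTheory GRing.Theory Num.Theory.
Import numFieldNormedType.Exports.
Local Open Scope classical_set_scope.
Local Open Scope ring_scope.

(** The two maximal quotients are compared for each fixed angle θ. Lift x in the simplex to the unit
    vector X = (√x_1, ..., √x_d, √(1-|x|)). Then d_T is the geodesic distance between lifts, the
    lift of ψ(y) has coordinates |Y_j|, and e(x,θ) is a cap about X. Put q_j = (θ/(X_j+θ))^2, so
    that q_j^κ_j = θ^(2κ_j) / (X_j+θ)^(2κ_j), and K = C ∏ q_j^κ_j.

    Upper bound for V ([VBk_cap_le]): the average of the cap indicator at Y(y) vanishes unless
    d_T(x,ψ(y)) ≤ θ, because replacing Y by |Y| only increases the inner product with X; it is at
    most K, because inside the cap each X_j(|Y_j| - Y_j t_j) is at most 1 - cos θ, which confines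
    t_j to distance O(q_j) from ±1. Substituting z = ψ(y) bounds the numerator on the ball by K
    times the numerator on the simplex ([MB_numerator_le]).

    Denominators: the d_T-ball of radius θ has W^T-mass at most C θ^d ∏ (X_j+θ)^(2κ_j)
    ([MT_denominator_le]), while the denominator on the ball is at least c θ^d ∏ θ^(2κ_j)
    ([MB_denominator_ge]). In K times the first bound the factors (X_j+θ)^(2κ_j) cancel and a
    multiple of the second remains, so the quotients compare with a constant independent of f, x and
    θ.

    The measurability of the iterated integrands is never established. Integrals of nonnegative
    functions are therefore handled as suprema over simple minorants; these remain monotone and
    homogeneous, and the substitution by squares is proved only as the inequality that is used. *)

(** * Monotonicity and homogeneity of the integral of arbitrary nonnegative functions *)

Section LowerIntegral.
Context {d : measure_display} {T : measurableType d} {R : realType}.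
Variable mu : {measure set T -> \bar R}.
Import HBSimple HBNNSimple.

(** A simple minorant of f, set to 0 on N, keeps its integral and becomes a minorant of g. *)
Lemma ge0_integral_le_off_null (D N : set T) (f g : T -> \bar R) :
  measurable N -> mu N = 0%E ->
  (forall x, D x -> (0 <= f x)%E) -> (forall x, D x -> (0 <= g x)%E) ->
  (forall x, D x -> ~ N x -> (f x <= g x)%E) ->
  (\int[mu]_(x in D) f x <= \int[mu]_(x in D) g x)%E.
Proof.
move=> mN N0 f0 g0 fg; rewrite !ge0_integralE//.
apply: ge_ereal_sup => _ [h/= hf <-].
pose h' := proj_nnsfun h (measurableC mN).
have -> : sintegral mu h = sintegral mu h'.
  rewrite -!integralT_nnsfun; apply: ae_eq_integral => //.
  - exact/measurable_EFinP.
  - exact/measurable_EFinP.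
  - exists N; split => // x /=; apply: contra_notP => Nx _.
    by rewrite /h' /= mindicE mem_set ?mulr1.
apply: ereal_sup_ubound; exists h' => //= x.
rewrite /patch; case: ifPn => [|xD].
- rewrite inE => Dx; rewrite mindicE.
  case: (boolP (x \in ~` N)) => [|_].
  + rewrite inE => Nx; rewrite mulr1; apply: le_trans (fg _ Dx Nx).
    by have := hf x; rewrite /patch mem_set.
  + by rewrite mulr0 g0.
- have := hf x; rewrite /patch (negbTE xD) lee_fin => hx.
  rewrite lee_fin; apply: le_trans hx; rewrite ler_piMr// mindicE.
  by case: (_ \in _).
Qed.

Lemma ge0_integral_le (D : set T) (f g : T -> \bar R) :
  (forall x, D x -> (0 <= f x)%E) ->
  (forall x, D x -> (f x <= g x)%E) ->
  (\int[mu]_(x in D) f x <= \int[mu]_(x in D) g x)%E.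
Proof.
move=> f0 fg; apply: (@ge0_integral_le_off_null _ set0) => //.
- by move=> x Dx; exact: le_trans (f0 x Dx) (fg x Dx).
- by move=> x Dx _; exact: fg.
Qed.

Let integralZl_le (D : set T) (f : T -> \bar R) (k : R) :
  0 < k -> (forall x, D x -> (0 <= f x)%E) ->
  (\int[mu]_(x in D) (k%:E * f x) <= k%:E * \int[mu]_(x in D) f x)%E.
Proof.
move=> k0 f0; have kf0 x : D x -> (0 <= k%:E * f x)%E.
  by move=> Dx; apply: mule_ge0; [rewrite lee_fin ltW|exact: f0].
rewrite !ge0_integralE//.
apply: ge_ereal_sup => _ [h/= hf <-].
have ki0 : 0 <= k^-1 by rewrite invr_ge0 ltW.
pose h' := scale_nnsfun h ki0.
have -> : sintegral mu h = (k%:E * sintegral mu h')%E.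
  rewrite -sintegralrM; apply: eq_sintegral => x /=; rewrite /h' /=.
  by rewrite mulrA divff ?mul1r// gt_eqF.
rewrite lee_pmul2l ?lte_fin//.
apply: ereal_sup_ubound; exists h' => //= x.
have := hf x; rewrite /patch; case: ifPn => [xD|xD].
- move=> h1; rewrite -(@lee_pmul2l _ k%:E) ?lte_fin// -EFinM.
  by rewrite mulrA divff ?mul1r// gt_eqF.
- by rewrite !lee_fin => h1; rewrite mulr_ge0_le0.
Qed.

Lemma ge0_integralZl_nomeas (D : set T) (f : T -> \bar R) (k : R) :
  0 <= k -> (forall x, D x -> (0 <= f x)%E) ->
  (\int[mu]_(x in D) (k%:E * f x) = k%:E * \int[mu]_(x in D) f x)%E.
Proof.
rewrite le_eqVlt => /predU1P[<- f0|k0 f0].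
  by rewrite mul0e integral0_eq// => x _; rewrite mul0e.
apply/eqP; rewrite eq_le integralZl_le//=.
have ki0 : 0 < k^-1 by rewrite invr_gt0.
(* The reverse inequality is the one already proved, for the factor 1/k and the function k f. *)
have := @integralZl_le D (fun x => k%:E * f x)%E _ ki0.
have kk : k^-1 * k = 1 by rewrite mulVf// gt_eqF.
have -> : (fun x => k^-1%:E * (k%:E * f x))%E = f.
  by apply/funext => x; rewrite muleA -EFinM kk mul1e.
move=> /(_ _) h; rewrite -(@lee_pmul2l _ k^-1%:E) ?lte_fin//.
rewrite muleA -EFinM kk mul1e; apply: h => x Dx.
by apply: mule_ge0; [rewrite lee_fin ltW|exact: f0].
Qed.

Lemma ge0_integralZr_nomeas (D : set T) (f : T -> \bar R) (k : R) :
  0 <= k -> (forall x, D x -> (0 <= f x)%E) ->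
  (\int[mu]_(x in D) (f x * k%:E) = (\int[mu]_(x in D) f x) * k%:E)%E.
Proof.
move=> k0 f0; under eq_integral do rewrite muleC.
by rewrite ge0_integralZl_nomeas// muleC.
Qed.

End LowerIntegral.

(** * Integrals of powers, and reflection of the line *)

Section PowerIntegral.
Context {R : realType}.
Notation mu := (@lebesgue_measure R).

Lemma integral_powRB1_itvcc (k a b : R) : 0 < k -> 0 < a -> a < b ->
  (\int[mu]_(s in `[a, b]) (s `^ (k - 1))%:E = ((b `^ k - a `^ k) / k)%:E)%E.
Proof.
move=> k0 a0 ab.
have D (s : R) : 0 < s -> is_derive s 1 (fun s : R => s `^ k / k) (s `^ (k - 1)).
  move=> s0.
  have -> : (fun s : R => s `^ k / k) = k^-1 \*: (fun s : R => s `^ k).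
    by apply/funext => x; rewrite /= mulrC.
  have := @is_deriveZ _ _ _ (fun s : R => s `^ k) k^-1 s 1 _ (is_derive1_powR k s0).
  by rewrite /GRing.scale/= mulrA mulVf ?mul1r// gt_eqF.
have C (s : R) : 0 < s -> {for s, continuous (fun s : R => s `^ k / k)}.
  move=> s0; apply: differentiable_continuous; apply/derivable1_diffP.
  by have [] := D s s0.
rewrite (@continuous_FTC2 _ _ (fun s : R => s `^ k / k)) //.
- by rewrite -EFinB -mulrBl.
- apply: continuous_in_subspaceT => s; rewrite inE/= in_itv/= => /andP[ass _].
  apply: differentiable_continuous; apply/derivable1_diffP.
  by apply: derivable_powR; rewrite in_itv/= andbT (lt_le_trans a0).
- split.
  + move=> s; rewrite in_itv/= => /andP[ass _].
    by have [] := D s (lt_trans a0 ass).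
  + by apply: cvg_at_right_filter; exact: C.
  + by apply: cvg_at_left_filter; apply: C; exact: lt_trans ab.
- move=> s; rewrite in_itv/= => /andP[ass _].
  by rewrite derive1E; have [_ ->] := D s (lt_trans a0 ass).
Qed.

Let measurable_powRB1 (k : R) (D : set R) :
  measurable_fun D (fun s : R => (s `^ (k - 1))%:E).
Proof. by apply/measurable_EFinP; exact: measurable_funTS. Qed.

Lemma integral_powRB1 (k a b : R) : 0 < k -> 0 <= a -> a <= b ->
  (\int[mu]_(s in `]a, b]) (s `^ (k - 1))%:E = ((b `^ k - a `^ k) / k)%:E)%E.
Proof.
move=> k0 a0; rewrite le_eqVlt => /predU1P[<-|ab].
  by rewrite set_itvoc0 integral_set0 subrr mul0r.
move: a0; rewrite le_eqVlt => /predU1P[a0|a0]; last first.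
  by rewrite integral_itv_obnd_cbnd ?integral_powRB1_itvcc//;
     exact: measurable_powRB1.
rewrite -{a}a0 in ab *; rewrite (powR0 (lt0r_neq0 k0)) subr0.
(* For a = 0 the power may be singular at the left end, so ]0, b] is exhausted by compact intervals
   on which the fundamental theorem applies. Starting at b/2 keeps each of them nondegenerate. *)
pose F n := `[b / n.+2%:R, b]%classic : set R.
have bF : \bigcup_n F n = `]0, b]%classic.
  apply/seteqP; split => [x [n _]|x]; rewrite /F/= !in_itv/= => /andP[x1 x2].
    by rewrite x2 andbT (lt_le_trans _ x1)// divr_gt0.
  exists (Num.trunc (b / x)) => //=; rewrite in_itv/= x2 andbT.
  rewrite ler_pdivrMr// mulrC -ler_pdivrMr//; apply: ltW.
  have := truncnS_gt (b / x) => /lt_le_trans; apply.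
  by rewrite ler_nat.
have Fn n : (\int[mu]_(s in F n) (s `^ (k - 1))%:E =
    ((b `^ k - (b / n.+2%:R) `^ k) / k)%:E)%E.
  rewrite integral_powRB1_itvcc// ?divr_gt0// ltr_pdivrMr// ltr_pMr//.
  by rewrite ltr1n.
have lim1 : (\int[mu]_(s in F n) (s `^ (k - 1))%:E)%E @[n --> \oo] -->
    (\int[mu]_(s in `]0%R, b]) (s `^ (k - 1))%:E)%E.
  rewrite -bF; apply: ge0_nondecreasing_set_cvg_integral => //.
  - move=> m n mn; apply/subsetPset => x; rewrite /F/= !in_itv/= => /andP[x1 ->].
    rewrite andbT (le_trans _ x1)// ler_pM2l// lef_pV2 ?posrE//.
    by rewrite ler_nat.
  - by move=> i; exact: measurable_itv.
  - by move=> i; exact: measurable_powRB1.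
  - by move=> i x _; rewrite lee_fin powR_ge0.
suff lim2 : (\int[mu]_(s in F n) (s `^ (k - 1))%:E)%E @[n --> \oo] -->
    (b `^ k / k)%:E by exact: cvg_unique lim1 lim2.
under eq_fun do rewrite Fn.
apply: cvg_EFin; first by near=> n.
apply: cvgMr_tmp.
rewrite -[X in _ --> X]subr0; apply: cvgB; first exact: cvg_cst.
have /cvg_at_rightP := powR_cvg0 k0.
apply; split => [n|]; first by rewrite divr_gt0.
rewrite -(mulr0 b); apply: cvgMl_tmp.
by have := @cvg_harmonic R; rewrite -cvg_shiftS.
Unshelve. all: by end_near. Qed.

Lemma ge0_integral_comp_onem (c : R) (f : R -> \bar R) :
  measurable_fun setT f -> (forall x, (0 <= f x)%E) ->
  (\int[mu]_x f (c - x)%R = \int[mu]_x f x)%E.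
Proof.
move=> mf f0.
pose phi : measurableTypeR R -> measurableTypeR R := fun x => (c - x)%R.
have mphi : measurable_fun setT phi by exact: measurable_funB.
(* Invariance under x ↦ c - x, by uniqueness of Lebesgue measure from its values on half-open
   intervals. *)
have E A : measurable A -> mu A = pushforward mu phi A.
  apply: (@lebesgue_measure_unique _ (pushforward mu phi)) => _ [[a b] _ <-].
  change (mu `]a, b]%classic = mu (phi @^-1` `]a, b]%classic)); rewrite /phi.
  have -> : (fun x => c - x)%R @^-1` `]a, b] = `[c - b, c - a[%classic.
    by apply/seteqP; split => x; rewrite /= !in_itv/=; lra.
  rewrite !lebesgue_measure_itv/= !lte_fin.
  have -> : (c - b < c - a) = (a < b) by apply/idP/idP; lra.
  by case: ifP => // _; rewrite -!EFinB; congr EFin; ring.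
rewrite [RHS](eq_measure_integral (pushforward mu phi)); last first.
  by move=> A mA _; exact: E.
by rewrite ge0_integral_pushforward// => x _; exact: f0.
Qed.

End PowerIntegral.

(** * The substitution s = t^2, with both square roots *)

Section SquareRootSubstitution.
Context {R : realType}.
Notation mu := (@lebesgue_measure R).

Let sqrt_density (s : R) : R := s `^ (2^-1 - 1) / 2.

Let sqrt_density_ge0 s : 0 <= sqrt_density s.
Proof. by rewrite divr_ge0 ?powR_ge0. Qed.

Let measurable_sqrt_density : measurable_fun setT sqrt_density.
Proof. by apply: measurable_funM => //; exact: measurable_powR. Qed.

Let measurable_sqrt : measurable_fun setT (@Num.sqrt R).
Proof. by apply: continuous_measurable_fun; exact: sqrt_continuous. Qed.

Let two_roots (A : set (measurableTypeR R)) (s : R) : \bar R :=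
  ((sqrt_density s)%:E * (dirac (Num.sqrt s : measurableTypeR R) A +
                          dirac (- Num.sqrt s : measurableTypeR R)%R A))%E.

Let measurable_two_roots (A : set (measurableTypeR R)) : measurable A ->
  measurable_fun setT (two_roots A).
Proof.
move=> mA; apply: emeasurable_funM; first exact/measurable_EFinP.
have m1 : measurable_fun setT (\1_A : R -> R) by exact: measurable_indic.
apply: emeasurable_funD; apply/measurable_EFinP; first exact: measurableT_comp.
by apply: measurableT_comp => //; exact: measurableT_comp.
Qed.

Let two_roots_ge0 A s : (0 <= two_roots A s)%E.
Proof. by rewrite mule_ge0 ?lee_fin ?adde_ge0. Qed.

(** The sum of the images of the measure s^(-1/2)/2 ds under s ↦ √s and s ↦ -√s. It turns out to be
    Lebesgue measure, which is the change of variables s = t^2. *)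
Definition two_roots_measure (A : set (measurableTypeR R)) : \bar R :=
  (\int[mu]_(s in `]0%R, +oo[) two_roots A s)%E.

Let two_roots_measure0 : two_roots_measure set0 = 0%E.
Proof. by apply: integral0_eq => s _; rewrite /two_roots !measure0 adde0 mule0. Qed.

Let two_roots_measure_ge0 A : (0 <= two_roots_measure A)%E.
Proof. exact: integral_ge0. Qed.

Let two_roots_measure_sigma_additive : semi_sigma_additive two_roots_measure.
Proof.
move=> F mF tF mUF.
have -> : two_roots_measure (\bigcup_n F n) =
    (\sum_(n <oo) two_roots_measure (F n))%E.
  rewrite /two_roots_measure -integral_nneseries//; last first.
    by move=> n; apply: measurable_funTS; exact: measurable_two_roots.
  apply: eq_integral => s _; rewrite /two_roots nneseriesZl => [|i _]; last first.
    by rewrite adde_ge0.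
  by rewrite nneseriesD// !measure_semi_bigcup.
by apply: is_cvg_nneseries => n _ _; exact: two_roots_measure_ge0.
Qed.

HB.instance Definition _ := isMeasure.Build _ _ _ two_roots_measure
  two_roots_measure0 two_roots_measure_ge0 two_roots_measure_sigma_additive.

(** A primitive of s^(-1/2)/2 is √s. The set S is constrained only off the two endpoints, since
    reflecting a half-open interval swaps its open and closed ends. *)
Let integral_sqrt_density (a b : R) (S : set R) : 0 <= a -> a <= b ->
  (forall s, 0 < s -> s != a ^+ 2 -> s != b ^+ 2 ->
     \1_S s = \1_`]a ^+ 2, b ^+ 2] s :> R) ->
  (\int[mu]_(s in `]0%R, +oo[) ((sqrt_density s)%:E * (\1_S s)%:E) =
   (b - a)%:E)%E.
Proof.
move=> a0 ab HS.
have b0 : 0 <= b by exact: le_trans ab.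
pose N : set R := [set a ^+ 2; b ^+ 2].
pose I : set R := `]a ^+ 2, b ^+ 2]%classic.
have mN : measurable N by exact: measurableU.
have N0 : mu N = 0%E.
  by apply: countable_lebesgue_measure0; apply: finite_set_countable;
     exact: finite_set2.
have ge0 (A : set R) s : (0 <= (sqrt_density s)%:E * (\1_A s)%:E)%E.
  by rewrite mule_ge0 ?lee_fin.
transitivity (\int[mu]_(s in `]0%R, +oo[)
    ((sqrt_density s)%:E * (\1_I s)%:E))%E.
  apply/eqP; rewrite eq_le; apply/andP; split;
    apply: (@ge0_integral_le_off_null _ _ R mu _ N) => // s; rewrite /= in_itv/= andbT => s0;
    move=> /not_orP[/eqP s1 /eqP s2]; rewrite HS//.
transitivity (\int[mu]_(s in I) (sqrt_density s)%:E)%E.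
  rewrite integral_mkcond [RHS]integral_mkcond; apply: eq_integral => s _.
  rewrite !patchE indicE; case: (boolP (s \in I)) => [|_]; last first.
    by rewrite mule0; case: ifP.
  rewrite inE /I /= in_itv/= => /andP[h1 h2]; rewrite mule1 mem_set//= in_itv/= andbT.
  by apply: le_lt_trans h1; exact: sqr_ge0.
rewrite /I; under eq_integral do rewrite /sqrt_density EFinM.
rewrite ge0_integralZr_nomeas//; last by move=> s _; rewrite lee_fin powR_ge0.
rewrite integral_powRB1// ?sqr_ge0// ?lerXn2r//.
by rewrite !powR12_sqrt ?sqr_ge0// !sqrtr_sqr !ger0_norm// -EFinM; congr EFin; field.
Qed.

Lemma lebesgue_measure_two_roots (A : set R) : measurable A ->
  mu A = two_roots_measure A.
Proof.
apply: lebesgue_measure_unique => _ [[a b] _ <-] /=.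
have [ba|ab] := leP b a.
  rewrite set_itv_ge ?measure0//= bnd_simp -leNgt//.
(* With [pp] the positive part, ]a, b] splits into a piece of length pp b - pp a reached by √s and a
   piece of length pp (-a) - pp (-b) reached by -√s. *)
pose pp (x : R) := Num.max x 0.
pose J : set R := `]a, b]%classic.
have sqE (x s : R) : 0 < s -> (pp x ^+ 2 < s) = (x < Num.sqrt s).
  move=> s0; rewrite -[s in LHS]sqr_sqrtr ?ltW// ltr_pXn2r ?nnegrE ?sqrtr_ge0//.
    by rewrite /pp gt_max sqrtr_gt0 s0 andbT.
  by rewrite /pp le_max lexx orbT.
have pp0 x : 0 <= pp x by rewrite le_max lexx orbT.
have ppab : pp a <= pp b.
  by rewrite /pp ge_max !le_max lexx orbT andbT ltW.
have ppba : pp (- b) <= pp (- a).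
  by rewrite /pp ge_max !le_max lexx orbT andbT lerN2 ltW.
have M (f : R -> R) : measurable_fun setT f -> measurable_fun (`]0, +oo[%classic : set R)
    (fun s : R => (sqrt_density s)%:E * (\1_(f @^-1` J)%classic s : R)%:E)%E.
  move=> mf; apply: emeasurable_funM.
    by apply/measurable_EFinP; exact: measurable_funTS.
  apply/measurable_EFinP; apply: measurable_funTS.
  change (measurable_fun setT ((\1_J : R -> R) \o f)).
  have mJ : measurable J by exact: measurable_itv.
  by apply: measurableT_comp => //; exact: measurable_indic.
rewrite lebesgue_measure_itv/= lte_fin ab.
transitivity ((pp b - pp a)%:E + (pp (- a) - pp (- b))%:E)%E.
  rewrite -EFinB -?EFinD; congr EFin; rewrite /pp.
  by case: (ltP b 0); case: (ltP a 0); case: (ltP (- b) 0); case: (ltP (- a) 0); lra.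
rewrite -(@integral_sqrt_density _ _ (Num.sqrt @^-1` J)%classic)//; last first.
  move=> s s0 _ _; rewrite !indicE; congr (_%:R); congr nat_of_bool.
  by apply/idP/idP; rewrite !inE /J /= !in_itv/= sqE// [s <= _]leNgt sqE// -leNgt.
rewrite -(@integral_sqrt_density _ _ ((fun s => - Num.sqrt s) @^-1` J)%classic)//; last first.
  move=> s s0 sb sa; rewrite !indicE; congr (_%:R); congr nat_of_bool.
  have E1 : (Num.sqrt s != - a).
    apply: contraNneq sa => E; rewrite /pp -E max_l ?sqrtr_ge0// sqr_sqrtr//.
    exact: ltW.
  have E2 : (Num.sqrt s != - b).
    apply: contraNneq sb => E; rewrite /pp -E max_l ?sqrtr_ge0// sqr_sqrtr//.
    exact: ltW.
  apply/idP/idP; rewrite !inE /J /= !in_itv/= sqE// [s <= _]leNgt sqE// -leNgt.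
    by case/andP => h1 h2; apply/andP; split; [rewrite lt_neqAle eq_sym E2|]; lra.
  by case/andP => h1 h2; apply/andP; split; [rewrite ltrNr lt_neqAle E1|]; lra.
rewrite -ge0_integralD//.
- apply: eq_integral => s _. rewrite -ge0_muleDr//.
- by move=> s _; rewrite mule_ge0 ?lee_fin.
- exact: M.
- by move=> s _; rewrite mule_ge0 ?lee_fin.
- by apply: M; exact: measurableT_comp.
Qed.

Import HBSimple HBNNSimple.

Lemma sintegral_two_roots (g : {nnsfun (measurableTypeR R) >-> R}) :
  (sintegral mu g = \int[mu]_(s in `]0%R, +oo[)
    ((s `^ (2^-1 - 1) / 2)%:E * ((g (Num.sqrt s))%:E + (g (- Num.sqrt s)%R)%:E)))%E.
Proof.
rewrite sintegralE.
transitivity (\sum_(r \in range g) r%:E * two_roots_measure (g @^-1` [set r]))%E.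
  apply: eq_fsbigr => r _; congr (_ * _)%E.
  have mg : measurable_fun setT g by [].
  apply: lebesgue_measure_two_roots; rewrite -[X in measurable X]setTI.
  exact: mg.
have mr r : measurable_fun (`]0, +oo[%classic : set R) (two_roots (g @^-1` [set r])).
  by apply: measurable_funTS; exact: measurable_two_roots.
transitivity (\sum_(r \in range g) \int[mu]_(s in `]0%R, +oo[)
    (r%:E * two_roots (g @^-1` [set r]) s))%E.
  apply: eq_fsbigr => r; rewrite inE => -[x _ <-].
  by rewrite ge0_integralZl_EFin//; exact: mr.
have r0 r s : (0 <= r%:E * two_roots (g @^-1` [set r]) s)%E.
  have [r0|r0] := leP 0 r; first exact: mule_ge0.
  by rewrite /two_roots preimage_nnfun0// !measure0 adde0 !mule0.
have mrr r : measurable_fun (`]0, +oo[%classic : set R)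
    (fun s => r%:E * two_roots (g @^-1` [set r]) s)%E.
  apply: emeasurable_funM; [exact: measurable_cst|exact: mr].
rewrite -ge0_integral_fsum//.
apply: eq_integral => s _; rewrite /two_roots.
have E (x : measurableTypeR R) :
    ((g x)%:E = \sum_(r \in range g) r%:E * dirac x (g @^-1` [set r]))%E.
  by rewrite fimfunE -fsumEFin.
have aux (r c u v : R) : (r%:E * (c%:E * (u%:E + v%:E)) =
    c%:E * (r%:E * u%:E + r%:E * v%:E))%E.
  by rewrite -!EFinM; congr EFin; ring.
rewrite !E -fsbig_split//= ge0_mule_fsumr.
  apply: eq_fsbigr => r _.
  exact: aux.
by move=> r; apply: adde_ge0; exact: nnsfun_mulemu_ge0.
Qed.

(** The cut-off removes the default value that [powR] takes at a negative base. *)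
Definition half_line_powR (p s : R) : R := if 0 <= s then s `^ p else 0.

Lemma half_line_powR_ge0 p s : 0 <= half_line_powR p s.
Proof. by rewrite /half_line_powR; case: ifP => // _; exact: powR_ge0. Qed.

(** A simple minorant g of the left integrand satisfies g(±√s) ≤ h(s) s^k. Its integral, rewritten
    in s, carries the density s^(-1/2)/2 twice, which produces the exponent k - 1/2. *)
Lemma ge0_integral_comp_sqr_le (k : R) (h : R -> \bar R) :
  (forall s, (0 <= h s)%E) ->
  (\int[mu]_t (h (t ^+ 2)%R * (`|t| `^ (2 * k))%:E) <=
   \int[mu]_s (h s * (half_line_powR (k - 2^-1)%R s)%:E))%E.
Proof.
move=> h0; rewrite ge0_integralE; last first.
  by move=> t _; apply: mule_ge0 => //; rewrite lee_fin powR_ge0.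
apply: ge_ereal_sup => _ [g /= gh <-].
rewrite sintegral_two_roots [leLHS]integral_mkcond.
have dens0 s : 0 <= s `^ (2^-1 - 1) / 2 :> R by rewrite divr_ge0 ?powR_ge0.
apply: ge0_integral_le => s _; rewrite patchE.
  by case: ifP => // _; apply: mule_ge0; [rewrite lee_fin|apply: adde_ge0; rewrite lee_fin].
case: ifPn => [|_]; last first.
  by rewrite mule_ge0// lee_fin half_line_powR_ge0.
rewrite inE/= in_itv/= andbT => s0.
have gle t : t ^+ 2 = s -> `|t| = Num.sqrt s -> ((g t)%:E <= h s * (s `^ k)%:E)%E.
  move=> ts tn; have := gh t; rewrite patch_setT ts tn => /le_trans; apply.
  by rewrite powRrM powR_mulrn ?sqrtr_ge0// sqr_sqrtr// ltW.
have g1 : ((g (Num.sqrt s))%:E <= h s * (s `^ k)%:E)%E.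
  by apply: gle; [rewrite sqr_sqrtr// ltW|rewrite ger0_norm// sqrtr_ge0].
have g2 : ((g (- Num.sqrt s)%R)%:E <= h s * (s `^ k)%:E)%E.
  by apply: gle; [rewrite sqrrN sqr_sqrtr// ltW|rewrite normrN ger0_norm// sqrtr_ge0].
rewrite /half_line_powR (ltW s0).
have E : s `^ (k - 2^-1) = s `^ k * s `^ (2^-1 - 1).
  by rewrite -powRD; [congr powR; lra|rewrite (gt_eqF s0) implybT].
have p1 : 0 < s `^ k by rewrite powR_gt0.
have p2 : 0 < s `^ (2^-1 - 1) by rewrite powR_gt0.
rewrite E; move: (h0 s) g1 g2; case: (h s) => [r| |//].
  rewrite -!EFinM !lee_fin => r0 g1 g2.
  have -> : r * (s `^ k * s `^ (2^-1 - 1)) =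
      s `^ (2^-1 - 1) / 2 * (r * s `^ k + r * s `^ k) by field.
  by rewrite ler_wpM2l// lerD.
by move=> _ _ _; rewrite gt0_mulye ?leey// lte_fin mulr_gt0.
Qed.

(** The density t^(-1/2) cut off to |√t - a| ≤ th. In the variable √t this is twice Lebesgue measure
    on a window, so its mass is O(th) uniformly in a, even though the density is singular at 0. *)
Definition sqrt_window (a th t : R) : R :=
  \1_(`]0, +oo[) t * \1_(`[a - th, a + th]) (Num.sqrt t) * t `^ (2^-1 - 1).

Lemma sqrt_window_ge0 a th t : 0 <= sqrt_window a th t.
Proof. by rewrite !mulr_ge0 ?powR_ge0. Qed.

Lemma sqrt_windowE a th t : sqrt_window a th t =
  if (0 < t) && (`|Num.sqrt t - a| <= th) then t `^ (2^-1 - 1) else 0.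
Proof.
rewrite /sqrt_window !indicE !mem_setE !in_itv/= andbT ler_distl.
by case: (0 < t); case: (_ <= _ <= _); rewrite ?mul1r ?mul0r.
Qed.

Lemma measurable_sqrt_window a th : measurable_fun setT (sqrt_window a th).
Proof.
apply: measurable_funM; last exact: measurable_powR.
apply: measurable_funM; first exact: measurable_indic.
have m : measurable_fun setT (\1_(`[a - th, a + th]%classic) : R -> R).
  exact: measurable_indic.
exact: measurableT_comp.
Qed.

(** In the variable √t the window has length at most 2 th and the density is 2. *)
Lemma integral_sqrt_window (a th : R) : 0 <= a -> 0 <= th ->
  (\int[mu]_t (sqrt_window a th t)%:E <= (4 * th)%:E)%E.
Proof.
move=> a0 th0; pose b := Num.max (a - th) 0.
have b0 : 0 <= b by rewrite le_max lexx orbT.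
have bth : b <= a + th by rewrite ge_max; lra.
pose J : set R := `]b ^+ 2, (a + th) ^+ 2]%classic.
apply: (@le_trans _ _ (\int[mu]_(t in J)
   (t `^ (2^-1 - 1)%R)%:E)%E); last first.
  have sq : b ^+ 2 <= (a + th) ^+ 2 by rewrite lerXn2r// nnegrE addr_ge0.
  rewrite /J integral_powRB1 ?sqr_ge0//.
  rewrite !powR12_sqrt ?sqr_ge0// !sqrtr_sqr !ger0_norm ?addr_ge0// lee_fin.
  have : a - th <= b by rewrite le_max lexx.
  lra.
rewrite [leRHS]integral_mkcond.
apply: (@ge0_integral_le_off_null _ _ R mu _ [set b ^+ 2]) => //.
- exact: lebesgue_measure_set1.
- by move=> t _; rewrite lee_fin sqrt_window_ge0.
- by move=> t _; rewrite patchE; case: ifP => // _; rewrite lee_fin powR_ge0.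
move=> t _ /= /eqP tb; rewrite sqrt_windowE patchE; case: ifPn; last first.
  by move=> _; case: ifP => // _; rewrite lee_fin powR_ge0.
move=> /andP[t0]; rewrite ler_distl => /andP[h1 h2].
have tE : t = Num.sqrt t ^+ 2 by rewrite sqr_sqrtr ?ltW.
rewrite mem_set//= /J /= in_itv/=; apply/andP; split.
  rewrite lt_neqAle eq_sym tb/= [leRHS]tE lerXn2r// ?nnegrE ?sqrtr_ge0//.
  by rewrite ge_max h1 sqrtr_ge0.
by rewrite [leLHS]tE lerXn2r// ?nnegrE ?sqrtr_ge0 ?addr_ge0.
Qed.

End SquareRootSubstitution.

(** * Merging two coordinates of a unit vector into one radius *)

Section WindowConvolution.
Context {R : realType}.
Notation mu := (@lebesgue_measure R).

Lemma powR_sqrt_inv (t : R) : 0 <= t -> t `^ (2^-1 - 1) = (Num.sqrt t)^-1.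
Proof.
move=> t0; have -> : 2^-1 - 1 = - 2^-1 :> R by field.
by rewrite powRN powR12_sqrt.
Qed.

Let hypot_le (a b th th' p q : R) : 0 <= a -> 0 <= b -> 0 <= th -> 0 <= th' ->
  0 <= p -> 0 <= q -> p <= a + th -> q <= b + th' ->
  Num.sqrt (p ^+ 2 + q ^+ 2) <= Num.sqrt (a ^+ 2 + b ^+ 2) + (th + th').
Proof.
move=> a0 b0 th0 th'0 p0 q0 pa qb; set r := Num.sqrt (a ^+ 2 + b ^+ 2).
have r0 : 0 <= r by exact: sqrtr_ge0.
have rE : r ^+ 2 = a ^+ 2 + b ^+ 2 by rewrite sqr_sqrtr// addr_ge0 ?sqr_ge0.
have ar : a <= r by rewrite -(ger0_norm a0) -sqrtr_sqr ler_wsqrtr// lerDl sqr_ge0.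
have br : b <= r by rewrite -(ger0_norm b0) -sqrtr_sqr ler_wsqrtr// lerDr sqr_ge0.
rewrite -[leRHS]ger0_norm ?addr_ge0// -sqrtr_sqr ler_wsqrtr//.
have hp : p ^+ 2 <= (a + th) ^+ 2 by rewrite lerXn2r// nnegrE addr_ge0.
have hq : q ^+ 2 <= (b + th') ^+ 2 by rewrite lerXn2r// nnegrE addr_ge0.
have h1 : a * th <= r * th by rewrite ler_wpM2r.
have h2 : b * th' <= r * th' by rewrite ler_wpM2r.
have h3 : 0 <= th * th' by rewrite mulr_ge0.
lra.
Qed.

Let dist_hypot_le (a b th th' p q : R) : 0 <= a -> 0 <= b -> 0 <= p -> 0 <= q ->
  `|p - a| <= th -> `|q - b| <= th' ->
  `|Num.sqrt (p ^+ 2 + q ^+ 2) - Num.sqrt (a ^+ 2 + b ^+ 2)| <= th + th'.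
Proof.
move=> a0 b0 p0 q0 pa qb.
have th0 : 0 <= th by exact: le_trans pa.
have th'0 : 0 <= th' by exact: le_trans qb.
move: pa qb; rewrite !ler_norml => /andP[pa1 pa2] /andP[qb1 qb2].
have := @hypot_le a b th th' p q a0 b0 th0 th'0 p0 q0.
have := @hypot_le p q th th' a b p0 q0 th0 th'0 a0 b0.
move=> /(_ _ _)/wrap[||h1]; [lra|lra|].
move=> /(_ _ _)/wrap[||h2]; [lra|lra|].
by apply/andP; split; lra.
Qed.

(* Since max (t, v - t) >= v / 2, the product of the two singular factors is
   at most 2 v^(-1/2) times their sum. *)
Lemma integral_two_sqrt_windows (a b th th' v : R) :
  0 <= a -> 0 <= b -> 0 <= th -> 0 <= th' ->
  (\int[mu]_t (sqrt_window a th t * sqrt_window b th' (v - t)%R)%:E <=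
   (8 * (th + th') *
    sqrt_window (Num.sqrt (a ^+ 2 + b ^+ 2)) (th + th') v)%:E)%E.
Proof.
move=> a0 b0 th0 th'0.
rewrite [X in (_ <= X%:E)%E]mulrC sqrt_windowE.
case: ifPn => [/andP[v0 _]|nP]; last first.
  rewrite mul0r le_eqVlt; apply/orP; left; apply/eqP; apply: integral0_eq => t _.
  rewrite !sqrt_windowE; case: ifPn => [/andP[t0 ta]|_]; last by rewrite mul0r.
  case: ifPn => [/andP[w0 wb]|_]; last by rewrite mulr0.
  exfalso; move/negP: nP; apply; apply/andP; split; first by lra.
  (* If both windows are nonzero at t, the point (√t, √(v-t)) of norm √v is close to (a, b) in each
     coordinate, so √v lies in the window about √(a^2+b^2). *)
  have := @dist_hypot_le a b th th' (Num.sqrt t) (Num.sqrt (v - t)) a0 b0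
    (sqrtr_ge0 _) (sqrtr_ge0 _) ta wb.
  rewrite (sqr_sqrtr (ltW t0)) (sqr_sqrtr (ltW w0)).
  by have -> : t + (v - t) = v by ring.
have mw := @measurable_sqrt_window R.
have mw2 : measurable_fun setT (fun t : R => sqrt_window b th' (v - t)).
  by apply: (measurableT_comp (mw _ _)) => //; exact: measurable_funB.
pose c := 2 * v `^ (2^-1 - 1).
have c0 : 0 <= c by rewrite mulr_ge0 ?powR_ge0.
apply: (@le_trans _ _ (\int[mu]_t
   (c%:E * ((sqrt_window a th t)%:E + (sqrt_window b th' (v - t)%R)%:E)))%E).
  apply: ge0_integral_le => t _; first by rewrite lee_fin mulr_ge0 ?sqrt_window_ge0.
  rewrite -EFinD -EFinM lee_fin.
  have := sqrt_window_ge0 a th t; have := sqrt_window_ge0 b th' (v - t).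
  rewrite !sqrt_windowE; case: ifPn => [/andP[w0 _]|_ _ h]; last first.
    by rewrite mulr0 mulr_ge0// addr_ge0.
  case: ifPn => [/andP[t0 _]|_ h _]; last by rewrite mul0r mulr_ge0// addr_ge0.
  move=> P1 P2; set x := t `^ _; set y := (v - t) `^ _.
  have [tv|tv] := leP (v / 2) t.
    have : x <= c.
      rewrite /x /c (powR_sqrt_inv (ltW v0)) (powR_sqrt_inv (ltW t0)).
      rewrite -[leRHS]invrK lef_pV2 ?posrE ?invr_gt0 ?mulr_gt0 ?invr_gt0 ?sqrtr_gt0//.
      rewrite invfM invrK ler_pdivrMl//.
      rewrite -[2]ger0_norm// -sqrtr_sqr -sqrtrM ?sqr_ge0// ler_wsqrtr//; lra.
    move=> xc; rewrite mulrDr; apply: (@le_trans _ _ (c * y)).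
      by rewrite ler_wpM2r.
    by rewrite lerDr mulr_ge0.
  have : y <= c.
    rewrite /y /c (powR_sqrt_inv (ltW v0)) (powR_sqrt_inv (ltW w0)).
    rewrite -[leRHS]invrK lef_pV2 ?posrE ?invr_gt0 ?mulr_gt0 ?invr_gt0 ?sqrtr_gt0//.
    rewrite invfM invrK ler_pdivrMl//.
    rewrite -[2]ger0_norm// -sqrtr_sqr -sqrtrM ?sqr_ge0// ler_wsqrtr//; lra.
  move=> yc; rewrite mulrDr mulrC; apply: (@le_trans _ _ (c * x)).
    by rewrite ler_wpM2r.
  by rewrite lerDl mulr_ge0.
rewrite ge0_integralZl_nomeas//; last first.
  by move=> t _; rewrite adde_ge0// lee_fin sqrt_window_ge0.
rewrite ge0_integralD//.
- rewrite (@ge0_integral_comp_onem _ v (fun t => (sqrt_window b th' t)%:E))//.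
  + apply: (@le_trans _ _ (c%:E * ((4 * th)%:E + (4 * th')%:E))%E).
      by rewrite lee_wpmul2l ?lee_fin// leeD// integral_sqrt_window.
    by rewrite -EFinD -EFinM lee_fin /c le_eqVlt; apply/orP; left; apply/eqP; ring.
  + by apply/measurable_EFinP; exact: mw.
  + by move=> x; rewrite lee_fin sqrt_window_ge0.
- by move=> t _; rewrite lee_fin sqrt_window_ge0.
- by apply/measurable_EFinP; exact: mw.
- by move=> t _; rewrite lee_fin sqrt_window_ge0.
- by apply/measurable_EFinP; exact: mw2.
Qed.

(** This is |√w - b| = |w - b^2| / (√w + b) ≤ 7be/b. *)
Let sqrt_close (b e w : R) : 0 < e -> 16 * e <= b ->
  b ^+ 2 - 7 * (b * e) <= w -> w <= b ^+ 2 + 7 * (b * e) ->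
  0 < w /\ `|Num.sqrt w - b| <= 7 * e.
Proof.
move=> e0 eb w1 w2; have b0 : 0 < b by lra.
have h : 16 * e * b <= b * b by rewrite ler_wpM2r// ltW.
have w0 : 0 < w.
  by have := mulr_gt0 e0 b0; rewrite expr2 in w1; lra.
split => //; rewrite ler_norml; apply/andP; split.
  rewrite lerBrDr -[leLHS]ger0_norm; last by lra.
  rewrite -sqrtr_sqr ler_wsqrtr//; rewrite !expr2 in w1 *.
  have : e * e * 16 <= b * e by nra.
  nra.
rewrite lerBlDr -[leRHS]ger0_norm; last by lra.
by rewrite -sqrtr_sqr ler_wsqrtr//; rewrite !expr2 in w2 *; nra.
Qed.

Lemma integral_ge_box (f : R -> R) (m x y : R) : 0 <= m -> x <= y ->
  (forall t, 0 <= f t) -> (forall t, x <= t <= y -> m <= f t) ->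
  ((m * (y - x))%:E <= \int[mu]_t (f t)%:E)%E.
Proof.
move=> m0 xy f0 mf.
apply: (@le_trans _ _ (\int[mu]_t (m%:E * (\1_(`[x, y]%classic : set R) t)%:E))%E).
  rewrite ge0_integralZl_nomeas//.
  rewrite integral_indic ?setIT; [|exact: measurableT|exact: measurable_itv].
  have E : lebesgue_measure (`[x, y]%classic : set R) = (y - x)%:E.
    rewrite lebesgue_measure_itv/= lte_fin; move: xy; rewrite le_eqVlt.
    by case/predU1P => [<-|->]; [rewrite ltxx subrr|rewrite EFinB].
  by rewrite [leRHS](congr1 (fun z => m%:E * z)%E E) -EFinM.
apply: ge0_integral_le => t _; first by rewrite mule_ge0 ?lee_fin.
rewrite -EFinM lee_fin indicE; case: (boolP (t \in _)) => [|_]; last by rewrite mulr0.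
by rewrite inE/= in_itv/= => h; rewrite mulr1 mf.
Qed.

(** If √v is within r/16 of the norm of (a, b), the circle of radius √v has an arc near (a, b) on
    which both coordinates stay in their windows. The integral is bounded below by a constant on an
    interval of t parametrizing such an arc. *)
Lemma integral_circle_window_ge (a b r rho v : R) :
  0 < r -> r <= a -> r <= b -> r <= rho ->
  ((r / 16 * sqrt_window (Num.sqrt (a ^+ 2 + b ^+ 2)) (r / 16) v)%:E <=
   \int[mu]_t (\1_(`[a - rho, a + rho]%classic : set R) t *
               sqrt_window b r (v - t ^+ 2)%R)%:E)%E.
Proof.
move=> r0 ra rb rrho.
have f0 t : 0 <= \1_(`[a - rho, a + rho]%classic : set R) t *
               sqrt_window b r (v - t ^+ 2)%R.
  by rewrite mulr_ge0 ?sqrt_window_ge0.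
rewrite [X in (X%:E <= _)%E]mulrC sqrt_windowE.
case: ifPn => [/andP[v0]|_]; last first.
  by rewrite mul0r; apply: integral_ge0 => t _; rewrite lee_fin.
pose e := r / 16; rewrite -/e; have e0 : 0 < e by rewrite divr_gt0.
have rE : r = 16 * e by rewrite /e; field.
set q := Num.sqrt (_ + _); set u := Num.sqrt v => hu.
have a0 : 0 < a by lra.
have b0 : 0 < b by lra.
have q0 : 0 <= q by exact: sqrtr_ge0.
have qE : q ^+ 2 = a ^+ 2 + b ^+ 2 by rewrite sqr_sqrtr// addr_ge0 ?sqr_ge0.
have u0 : 0 < u by rewrite sqrtr_gt0.
have uE : u ^+ 2 = v by rewrite sqr_sqrtr// ltW.
have aq : a <= q by rewrite -(ger0_norm (ltW a0)) -sqrtr_sqr ler_wsqrtr// lerDl sqr_ge0.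
move: hu; rewrite ler_norml => /andP[hu1 hu2].
have v1 : q ^+ 2 - 2 * (q * e) <= v.
  rewrite -uE; have : (q - e) ^+ 2 <= u ^+ 2 by rewrite lerXn2r ?nnegrE//; lra.
  by rewrite !expr2; nra.
have v2 : v <= q ^+ 2 + 2 * (q * e) + e ^+ 2.
  rewrite -uE; have : u ^+ 2 <= (q + e) ^+ 2 by rewrite lerXn2r ?nnegrE//; lra.
  by rewrite !expr2; nra.
rewrite (powR_sqrt_inv (ltW v0)) -/u.
have qle m : a <= m -> b <= m -> q <= 2 * m.
  move=> am bm; rewrite -[leRHS]ger0_norm ?mulr_ge0//; last by lra.
  rewrite -sqrtr_sqr ler_wsqrtr//.
  have : a ^+ 2 <= m ^+ 2 by rewrite lerXn2r ?nnegrE//; lra.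
  have : b ^+ 2 <= m ^+ 2 by rewrite lerXn2r ?nnegrE//; lra.
  by rewrite !expr2; nra.
(* For a ≤ b the first coordinate parametrizes the arc: all t within e of a are admissible, and the
   density (v-t^2)^(-1/2) is at least v^(-1/2). *)
have [ab|ba] := leP a b.
  have q2 := qle b ab (lexx _).
  apply: (@le_trans _ _ (u^-1 * ((a + e) - (a - e)))%:E).
    by rewrite lee_fin ler_wpM2l ?invr_ge0//; lra.
  apply: integral_ge_box => //; [by rewrite invr_ge0 ltW|lra|].
  move=> t /andP[t1 t2].
  have ht1 : (a - e) ^+ 2 <= t ^+ 2 by rewrite lerXn2r ?nnegrE//; lra.
  have ht2 : t ^+ 2 <= (a + e) ^+ 2 by rewrite lerXn2r ?nnegrE//; lra.
  have qe : q * e <= 2 * b * e by rewrite ler_wpM2r// ltW.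
  have ae : a * e <= b * e by rewrite ler_wpM2r// ltW.
  have ee : 16 * e * e <= b * e by rewrite ler_wpM2r//; lra.
  have [w0 wb] : 0 < v - t ^+ 2 /\ `|Num.sqrt (v - t ^+ 2) - b| <= 7 * e.
    by apply: sqrt_close => //; [lra| |]; rewrite !expr2 in qE v1 v2 ht1 ht2 *; lra.
  rewrite sqrt_windowE w0/= indicE mem_set ?mul1r; last first.
    by rewrite /= in_itv/=; lra.
  rewrite ifT; last by lra.
  rewrite (powR_sqrt_inv (ltW w0)) lef_pV2 ?posrE ?sqrtr_gt0//.
  by rewrite ler_wsqrtr// gerBl sqr_ge0.
have q2 := qle a (lexx _) (ltW ba).
have qe : q * e <= 2 * a * e by rewrite ler_wpM2r// ltW.
have be : b * e <= a * e by rewrite ler_wpM2r// ltW.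
have ee : 16 * e * e <= b * e by rewrite ler_wpM2r//; lra.
have ae0 : 0 < a * e by rewrite mulr_gt0.
have aa : 16 * e * a <= a * a by rewrite ler_wpM2r//; lra.
(* For b < a the second coordinate runs over [b-e, b+e], so t runs over [x, y]. There the density is
   at least 1/(2b), and y - x = 4be/(x+y) is at least 2be/√v. *)
pose x := Num.sqrt (v - (b + e) ^+ 2); pose y := Num.sqrt (v - (b - e) ^+ 2).
have p1 : 0 < v - (b + e) ^+ 2 by rewrite !expr2 in qE v1 v2 *; lra.
have p12 : v - (b + e) ^+ 2 <= v - (b - e) ^+ 2 by rewrite !expr2; have := mulr_gt0 b0 e0; lra.
have x0 : 0 < x by rewrite sqrtr_gt0.
have xy : x <= y by rewrite ler_wsqrtr.
have xE : x ^+ 2 = v - (b + e) ^+ 2 by rewrite sqr_sqrtr// ltW.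
have yE : y ^+ 2 = v - (b - e) ^+ 2 by rewrite sqr_sqrtr//; lra.
have yu : y <= u by rewrite ler_wsqrtr// gerBl sqr_ge0.
apply: (@le_trans _ _ ((2 * b)^-1 * (y - x))%:E).
  rewrite lee_fin ler_pdivrMl// mulrCA ler_pdivlMl; last by lra.
  have : (y - x) * (y + x) = 4 * b * e.
    by rewrite -subr_sqr xE yE !expr2; ring.
  have : 0 <= (y - x) * (2 * u - y - x) by rewrite mulr_ge0; lra.
  by nra.
apply: integral_ge_box => //; [by rewrite invr_ge0; lra|].
move=> t /andP[t1 t2].
have ht1 : x ^+ 2 <= t ^+ 2 by rewrite lerXn2r ?nnegrE//; lra.
have ht2 : t ^+ 2 <= y ^+ 2 by rewrite lerXn2r ?nnegrE//; lra.
have [_ ta] : 0 < t ^+ 2 /\ `|Num.sqrt (t ^+ 2) - a| <= 7 * e.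
  by apply: sqrt_close => //; [lra| |]; rewrite !expr2 in qE v1 v2 xE yE ht1 ht2 *; lra.
have t0 : 0 <= t by apply: le_trans t1; exact: ltW.
rewrite sqrtr_sqr (ger0_norm t0) in ta.
have w1 : (b - e) ^+ 2 <= v - t ^+ 2 by lra.
have w2 : v - t ^+ 2 <= (b + e) ^+ 2 by lra.
have w0 : 0 < v - t ^+ 2 by apply: lt_le_trans w1; rewrite exprn_gt0//; lra.
have s1 : b - e <= Num.sqrt (v - t ^+ 2).
  by rewrite -[leLHS]ger0_norm; [rewrite -sqrtr_sqr ler_wsqrtr|lra].
have s2 : Num.sqrt (v - t ^+ 2) <= b + e.
  by rewrite -[leRHS]ger0_norm; [rewrite -sqrtr_sqr ler_wsqrtr|lra].
rewrite sqrt_windowE w0/= indicE mem_set ?mul1r; last first.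
  by rewrite /= in_itv/=; move: ta; rewrite ler_norml; lra.
rewrite ifT; last by rewrite ler_norml; lra.
rewrite (powR_sqrt_inv (ltW w0)) lef_pV2 ?posrE ?sqrtr_gt0//; lra.
Qed.

End WindowConvolution.

(** * The one-variable average V near the endpoints ±1 *)

Section JacobiAverage.
Context {R : realType}.
Notation mu := (@lebesgue_measure R).

Lemma Vweight_ge0 (k t : R) : -1 <= t -> 0 <= Vweight k t.
Proof. by move=> t1; rewrite mulr_ge0 ?powR_ge0//; lra. Qed.

Lemma Vconst_ge0 (k : R) : 0 <= Vconst k.
Proof.
rewrite invr_ge0 fine_ge0// integral_ge0// => t; rewrite /= in_itv/= => /andP[t1 _].
by rewrite lee_fin Vweight_ge0.
Qed.

Lemma Vop1_ge0 (k : R) (h : R -> \bar R) :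
  (forall t, -1 <= t <= 1 -> (0 <= h t)%E) -> (0 <= Vop1 k h)%E.
Proof.
move=> h0; rewrite /Vop1; case: ifP => _.
  by rewrite mule_ge0 ?lee_fin ?invr_ge0// adde_ge0// h0//; lra.
rewrite mule_ge0 ?lee_fin ?Vconst_ge0// integral_ge0// => t.
rewrite /= in_itv/= => t1; rewrite mule_ge0 ?h0// lee_fin Vweight_ge0//.
by case/andP: t1.
Qed.

Lemma le_Vop1 (k : R) (h h' : R -> \bar R) :
  (forall t, -1 <= t <= 1 -> (0 <= h t)%E) ->
  (forall t, -1 <= t <= 1 -> (h t <= h' t)%E) -> (Vop1 k h <= Vop1 k h')%E.
Proof.
move=> h0 hh'; rewrite /Vop1; case: ifP => _.
  by rewrite lee_wpmul2r ?lee_fin ?invr_ge0// leeD// hh'//; lra.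
rewrite lee_wpmul2l ?lee_fin ?Vconst_ge0//.
apply: ge0_integral_le => t; rewrite /= in_itv/= => t1.
  rewrite mule_ge0 ?h0// lee_fin Vweight_ge0//; by case/andP: t1.
rewrite lee_wpmul2r ?hh'// lee_fin Vweight_ge0//; by case/andP: t1.
Qed.

Lemma Vop1Zl (k c : R) (h : R -> \bar R) : 0 <= c ->
  (forall t, -1 <= t <= 1 -> (0 <= h t)%E) ->
  (Vop1 k (fun t => c%:E * h t) = c%:E * Vop1 k h)%E.
Proof.
move=> c0 h0; rewrite /Vop1; case: ifP => _.
  by rewrite -ge0_muleDr ?h0 -?muleA//; lra.
under eq_integral do rewrite -muleA.
rewrite ge0_integralZl_nomeas// ?muleA; first by rewrite (muleC (Vconst k)%:E).
move=> t; rewrite /= in_itv/= => t1; rewrite mule_ge0 ?h0// lee_fin Vweight_ge0//.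
by case/andP: t1.
Qed.

(** Factor 1 - t^2 = (1-|t|)(1+|t|). The second factor lies in [1, 2], and its power k - 1, of
    either sign, is at most 2^k. *)
Let Vweight_le (k t : R) : 0 < k -> -1 < t -> t < 1 ->
  Vweight k t <= 2 * 2 `^ k * (1 - `|t|) `^ (k - 1).
Proof.
move=> k0 t1 t2; have nt : `|t| < 1 by rewrite ltr_norml t1.
have nt0 := normr_ge0 t.
rewrite /Vweight (_ : 1 - t ^+ 2 = (1 - `|t|) * (1 + `|t|)); last first.
  by rewrite -(real_normK (num_real t)); ring.
rewrite powRM; [|lra|lra].
have p : (1 + `|t|) `^ (k - 1) <= 2 `^ k.
  have [k1|k1] := leP 1 k.
    apply: (@le_trans _ _ (2 `^ (k - 1))).
      by rewrite ge0_ler_powR ?nnegrE; lra.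
    by rewrite ler_powR; lra.
  apply: (@le_trans _ _ ((1 + `|t|) `^ 0)); first by rewrite ler_powR; lra.
  by rewrite powRr0 -[leLHS](powRr0 2) ler_powR; lra.
have P0 := powR_ge0 (1 - `|t|) (k - 1).
have P1 := powR_ge0 (1 + `|t|) (k - 1).
rewrite mulrCA [leRHS]mulrC ler_wpM2l// ler_pM//; lra.
Qed.

Lemma integral_Vweight_le (k del : R) : 0 < k -> 0 < del ->
  (\int[mu]_(t in `[(-1)%R, 1%R])
     ((\1_[set t : R | 1 - `|t| <= del] t)%:E * (Vweight k t)%:E) <=
   (4 * 2 `^ k / k * del `^ k)%:E)%E.
Proof.
move=> k0 d0.
pose J : set R := `]0, del]%classic.
pose P (s : R) := (\1_J s * s `^ (k - 1))%:E.
have P0 s : (0 <= P s)%E by rewrite lee_fin mulr_ge0 ?powR_ge0.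
have mP : measurable_fun setT P.
  apply/measurable_EFinP; apply: measurable_funM; last exact: measurable_powR.
  by apply: measurable_indic; exact: measurable_itv.
have IP : (\int[mu]_s P s = (del `^ k / k)%:E)%E.
  have := @integral_powRB1 R k 0 del k0 (lexx _) (ltW d0).
  rewrite powR0 ?gt_eqF// subr0 => <-; rewrite [RHS]integral_mkcond.
  apply: eq_integral => s _; rewrite patchE /P indicE.
  by case: ifPn => _; rewrite ?mul1r ?mul0r.
pose c := 2 * 2 `^ k : R.
have c0 : 0 <= c by rewrite mulr_ge0 ?powR_ge0.
have PP t : (0 <= c%:E * (P (1 - t)%R + P (1 + t)%R))%E.
  by apply: mule_ge0 => //; exact: adde_ge0.
have IN : (\int[mu]_t P (1 + t)%R = (del `^ k / k)%:E)%E.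
  rewrite -IP -(@ge0_integral_comp_onem _ 1 P)//.
  rewrite -(@ge0_integral_comp_onem _ 0 (fun t => P (1 - t)%R))//; last first.
    by apply: (measurableT_comp mP); exact: measurable_funB.
  by apply: eq_integral => t _; congr P; ring.
apply: (@le_trans _ _ (\int[mu]_t (c%:E * (P (1 - t)%R + P (1 + t)%R)))%E); last first.
  rewrite ge0_integralZl_nomeas//; last by move=> t _; rewrite adde_ge0.
  rewrite ge0_integralD//; last 2 first.
  - by apply: (measurableT_comp mP); exact: measurable_funB.
  - by apply: (measurableT_comp mP); exact: measurable_funD.
  rewrite IN ge0_integral_comp_onem// IP -EFinD -EFinM lee_fin le_eqVlt /c.
  by apply/orP; left; apply/eqP; ring.
rewrite integral_mkcond.
apply: (@ge0_integral_le_off_null _ _ R mu _ [set (-1)%R; 1%R]) => //.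
- exact: measurableU.
- by apply: countable_lebesgue_measure0; apply: finite_set_countable;
     exact: finite_set2.
- move=> t _; rewrite patchE; case: ifPn => //; rewrite inE/= in_itv/= => /andP[t1 _].
  by rewrite mule_ge0 ?lee_fin// Vweight_ge0.
move=> t _ /not_orP[/eqP n1 /eqP n2]; rewrite patchE; case: ifPn; last first.
  by move=> _; exact: PP.
rewrite inE/= in_itv/= => /andP[t1' t2'].
have t1 : -1 < t by rewrite lt_neqAle eq_sym n1.
have t2 : t < 1 by rewrite lt_neqAle n2.
rewrite indicE; case: (boolP (t \in _)) => [|_]; last first.
  by rewrite mul0e; exact: PP.
rewrite inE/= => td; rewrite mul1e.
apply: (@le_trans _ _ (c%:E * P (1 - `|t|)%R)%E).
  rewrite /P -EFinM lee_fin indicE mem_set; last first.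
    by rewrite /J /= in_itv/= td andbT subr_gt0 ltr_norml t1.
  by rewrite mul1r Vweight_le.
apply: lee_wpmul2l; first by rewrite lee_fin.
have [t0|t0] := leP 0 t.
  by rewrite (ger0_norm t0); exact: leeDl.
by rewrite (ltr0_norm t0) opprK; exact: leeDr.
Qed.

Lemma integral_Vweight_ge (k del : R) : 0 < k -> 0 < del -> del <= 1 ->
  ((2^-1 / 2 `^ k * del `^ k)%:E <= \int[mu]_(t in `[(-1)%R, 1%R])
     ((\1_[set t : R | 1 - del <= t] t)%:E * (Vweight k t)%:E))%E.
Proof.
move=> k0 d0 d1.
have two0 : 0 < 2 `^ k :> R by rewrite powR_gt0.
rewrite [leRHS]integral_mkcond.
pose f (t : R) : R := if -1 <= t <= 1 then
  \1_[set t : R | 1 - del <= t] t * Vweight k t else 0.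
have -> : (((fun t : R => ((\1_[set t : R | 1 - del <= t] t)%:E * (Vweight k t)%:E)%E)
    \_ `[(-1)%R, 1%R]) = (fun t => (f t)%:E)).
  by apply/funext => t; rewrite patchE /f mem_setE in_itv/=; case: ifP.
(* Only t in [1 - del, 1 - del/2] is kept. There 1 - t is comparable to [del], whatever the sign of
   k - 1, and the interval has length del/2. *)
apply: (@le_trans _ _
  ((2 `^ k)^-1 * del `^ (k - 1) * ((1 - del / 2) - (1 - del)))%:E).
  rewrite lee_fin le_eqVlt; apply/orP; left; apply/eqP.
  by rewrite -(mulr_powRB1 (ltW d0) k0); field; rewrite gt_eqF.
apply: integral_ge_box.
- by rewrite mulr_ge0 ?powR_ge0// invr_ge0 powR_ge0.
- lra.
- move=> t; rewrite /f; case: ifPn => // /andP[t1 _].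
  by rewrite mulr_ge0 ?Vweight_ge0.
move=> t /andP[t1 t2].
rewrite /f ifT; last by lra.
rewrite indicE mem_set//= mul1r /Vweight.
have -> : 1 - t ^+ 2 = (1 - t) * (1 + t) by ring.
rewrite powRM; [|lra|lra].
have -> : (1 + t) * ((1 - t) `^ (k - 1) * (1 + t) `^ (k - 1)) =
    (1 - t) `^ (k - 1) * (1 + t) `^ k.
  by rewrite -[in RHS](mulr_powRB1 _ k0); [ring|lra].
apply: (@le_trans _ _ ((1 - t) `^ (k - 1))); last first.
  rewrite ler_peMr ?powR_ge0// -[leLHS](powRr0 (1 + t)) ler_powR//; lra.
have [k1|k1] := leP 1 k.
  apply: (@le_trans _ _ ((del / 2) `^ (k - 1))).
    rewrite powRM ?invr_ge0//; last exact: ltW.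
    rewrite mulrC ler_wpM2l ?powR_ge0// -!powR_inv1// -!powRrM.
    by rewrite mulrC ler_powR//; lra.
  by rewrite ge0_ler_powR ?nnegrE; lra.
apply: (@le_trans _ _ (del `^ (k - 1))).
  rewrite ler_piMl ?powR_ge0// invf_le1// -[leLHS](powRr0 2) ler_powR//; lra.
have -> : k - 1 = - (1 - k) by ring.
rewrite !powRN lef_pV2 ?posrE ?powR_gt0//; last by lra.
by rewrite ge0_ler_powR ?nnegrE; lra.
Qed.

(** The total mass of the weight must be shown finite as well as positive: [fine] sends an infinite
    mass to 0, and the normalizing constant would then be 0. *)
Lemma Vconst_gt0 (k : R) : 0 < k -> 0 < Vconst k.
Proof.
move=> k0; rewrite invr_gt0; apply: fine_gt0.
have E (A : set R) : (forall t, -1 <= t <= 1 -> A t) ->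
    (\int[mu]_(t in `[(-1)%R, 1%R]) (Vweight k t)%:E =
    \int[mu]_(t in `[(-1)%R, 1%R]) ((\1_A t)%:E * (Vweight k t)%:E))%E.
  move=> HA; apply: eq_integral => t; rewrite inE/= in_itv/= => t1.
  by rewrite indicE mem_set ?mul1e//; exact: HA.
apply/andP; split.
  apply: (@lt_le_trans _ _ (2^-1 / 2 `^ k * 1 `^ k)%:E).
    by rewrite lte_fin !mulr_gt0 ?invr_gt0 ?powR_gt0.
  apply: (le_trans (@integral_Vweight_ge k 1 k0 ltr01 (lexx _))).
  apply: ge0_integral_le => t; rewrite /= in_itv/= => /andP[t1 _].
    by rewrite mule_ge0 ?lee_fin// Vweight_ge0.
  by rewrite -EFinM lee_fin ler_piMl ?Vweight_ge0// indicE; case: (_ \in _).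
rewrite (E [set t : R | 1 - `|t| <= 1]) => [|t _ /=].
  by apply: (le_lt_trans (@integral_Vweight_le k 1 k0 ltr01)); rewrite ltey.
by rewrite gerBl.
Qed.

(** The average gives mass of order del^k to the points within [del] of ±1. For k = 0 it is the
    half-sum of the endpoint values, in agreement with del^0 = 1. Both endpoints are included
    because the coordinate multiplied by t may be negative; the matching lower bound [Vop1_ge_powR]
    only needs t near 1. *)
Lemma Vop1_le_powR (k : R) : 0 <= k -> exists2 C : R, 0 < C &
  forall del : R, 0 < del ->
  (Vop1 k (fun t => (\1_[set t : R | 1 - `|t| <= del] t)%:E) <=
   (C * del `^ k)%:E)%E.
Proof.
rewrite le_eqVlt => /predU1P[<-|k0].
  exists 1 => // del d0; rewrite /Vop1 eqxx powRr0 mul1r -EFinD -EFinM lee_fin.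
  by rewrite ler_pdivrMr// mul1r lerD// indicE; case: (_ \in _).
exists (Vconst k * (4 * 2 `^ k / k)).
  by rewrite !mulr_gt0 ?Vconst_gt0 ?powR_gt0 ?invr_gt0.
move=> del d0; rewrite /Vop1 gt_eqF//= -mulrA EFinM lee_wpmul2l ?lee_fin ?Vconst_ge0//.
exact: integral_Vweight_le.
Qed.

Lemma Vop1_ge_powR (k : R) : 0 <= k -> exists2 c : R, 0 < c &
  forall del : R, 0 < del -> del <= 1 ->
  ((c * del `^ k)%:E <=
   Vop1 k (fun t => (\1_[set t : R | 1 - del <= t] t)%:E))%E.
Proof.
rewrite le_eqVlt => /predU1P[<-|k0].
  exists 2^-1 => // del d0 d1; rewrite /Vop1 eqxx powRr0 mulr1 -EFinD -EFinM lee_fin.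
  rewrite ler_peMl// indicE mem_set/=; last by lra.
  by rewrite lerDl.
exists (Vconst k * (2^-1 / 2 `^ k)).
  by rewrite !mulr_gt0 ?Vconst_gt0 ?invr_gt0 ?powR_gt0.
move=> del d0 d1; rewrite /Vop1 gt_eqF//= -mulrA EFinM lee_wpmul2l ?lee_fin ?Vconst_ge0//.
exact: integral_Vweight_ge.
Qed.

End JacobiAverage.

(** * Iterated one-variable operators and product weights *)

Section IteratedOperators.
Context {R : realType}.
Notation mu := (@lebesgue_measure R).

(** Iteration over a sublist of the coordinates. The inductions below run on l, the coordinates
    outside l being parameters read from the base point. *)
Definition fold_op n (ops : 'I_n -> (R -> \bar R) -> \bar R) (l : seq 'I_n)
    (g : ('I_n -> R) -> \bar R) : ('I_n -> R) -> \bar R :=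
  foldr (fun i G => fun s => ops i (fun t => G (upd s i t))) g l.

Lemma iter_opE n (ops : 'I_n -> (R -> \bar R) -> \bar R) g :
  iter_op ops g = fold_op ops (enum 'I_n) g (fun _ => 0).
Proof. by []. Qed.

Lemma upd_eq n (s : 'I_n -> R) i t : upd s i t i = t.
Proof. by rewrite /upd eqxx. Qed.

Lemma upd_neq n (s : 'I_n -> R) i t j : j != i -> upd s i t j = s j.
Proof. by rewrite /upd => /negbTE ->. Qed.

Lemma big_notin_upd (T : Type) (idx : T) (op : Monoid.com_law idx) n
    (F : 'I_n -> R -> T) (l : seq 'I_n) (s : 'I_n -> R) i t : i \notin l ->
  \big[op/idx]_(j | j \notin l) F j (upd s i t j) =
  op (F i t) (\big[op/idx]_(j | j \notin i :: l) F j (s j)).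
Proof.
move=> il; rewrite (bigD1 i)//= upd_eq; congr (op _ _).
apply: eq_big => [j|j /andP[_ ji]]; last by rewrite upd_neq.
by rewrite inE negb_or andbC.
Qed.

Lemma big_notin_enum (T : Type) (idx : T) (op : Monoid.com_law idx) n
    (F : 'I_n -> T) :
  \big[op/idx]_(j | j \notin enum 'I_n) F j = idx.
Proof. by rewrite big_pred0// => j; rewrite mem_enum. Qed.

Lemma fold_op_ge0 n (ops : 'I_n -> (R -> \bar R) -> \bar R) g l s :
  (forall i h, (forall t, (0 <= h t)%E) -> (0 <= ops i h)%E) ->
  (forall s, (0 <= g s)%E) -> (0 <= fold_op ops l g s)%E.
Proof. by move=> ops0 g0; elim: l s => //= i l IH s; apply: ops0 => t. Qed.

Lemma le_fold_op n (ops : 'I_n -> (R -> \bar R) -> \bar R) g g' l s :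
  (forall i h h', (forall t, (0 <= h t)%E) -> (forall t, (h t <= h' t)%E) ->
    (ops i h <= ops i h')%E) ->
  (forall i h, (forall t, (0 <= h t)%E) -> (0 <= ops i h)%E) ->
  (forall s, (0 <= g s)%E) -> (forall s, (g s <= g' s)%E) ->
  (fold_op ops l g s <= fold_op ops l g' s)%E.
Proof.
move=> le_ops ops0 g0 gg'; elim: l s => //= i l IH s; apply: le_ops => // t.
exact: fold_op_ge0.
Qed.

Lemma intd_ge0 n (g : ('I_n -> R) -> \bar R) :
  (forall s, (0 <= g s)%E) -> (0 <= intd g)%E.
Proof.
by move=> g0; apply: fold_op_ge0 => // i h h0; exact: integral_ge0.
Qed.

Lemma le_intd n (g g' : ('I_n -> R) -> \bar R) :
  (forall s, (0 <= g s)%E) -> (forall s, (g s <= g' s)%E) ->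
  (intd g <= intd g')%E.
Proof.
move=> g0 gg'; apply: le_fold_op => //.
- by move=> i h h' h0 hh'; exact: ge0_integral_le.
- by move=> i h h0; exact: integral_ge0.
Qed.

Lemma intdZl n (c : R) (g : ('I_n -> R) -> \bar R) : 0 <= c ->
  (forall s, (0 <= g s)%E) -> (intd (fun s => c%:E * g s) = c%:E * intd g)%E.
Proof.
move=> c0 g0; rewrite /intd !iter_opE.
elim: (enum 'I_n) (fun _ => 0 : R) => //= i l IH s.
rewrite -ge0_integralZl_nomeas//; first by apply: eq_integral => t _; exact: IH.
by move=> t _; apply: fold_op_ge0 => // j h h0; exact: integral_ge0.
Qed.

Definition weighted_op n (w : 'I_n -> R -> R) (i : 'I_n) (h : R -> \bar R) : \bar R :=
  (\int[mu]_t (h t * (w i t)%:E))%E.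

(** A factor of the product that depends on an outer variable is constant for the inner integrals
    and can be moved out of them by homogeneity alone. *)
Lemma intd_weights n (F : ('I_n -> R) -> \bar R) (w : 'I_n -> R -> R) :
  (forall s, (0 <= F s)%E) -> (forall i t, 0 <= w i t) ->
  (intd (fun y => F y * (\prod_i w i (y i))%:E) = iter_op (weighted_op w) F)%E.
Proof.
move=> F0 w0; rewrite /intd !iter_opE; set I := fun _ _ => _.
have P l s : uniq l -> (fold_op I l (fun y => F y * (\prod_i w i (y i))%:E) s =
   (\prod_(j | j \notin l) w j (s j))%:E * fold_op (weighted_op w) l F s)%E.
  elim: l s => [|i l IH] s /=; first by rewrite muleC.
  move=> /andP[il ul]; rewrite /weighted_op -ge0_integralZl_nomeas//.
  - apply: eq_integral => t _; rewrite IH// (@big_notin_upd _ _ _ n w l s i t il) EFinM.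
    by rewrite -muleA muleC -muleA.
  - by rewrite prodr_ge0.
  - move=> t _; rewrite mule_ge0 ?lee_fin//; apply: fold_op_ge0 => // j h h0.
    by apply: integral_ge0 => u _; rewrite mule_ge0 ?lee_fin.
by rewrite P ?enum_uniq// big_notin_enum mul1e.
Qed.

(** The one-variable substitution, one coordinate at a time: the induction hypothesis replaces the
    inner iterate at [psi s], and then the outer variable t enters only through t^2. *)
Lemma iter_op_psi_le n (F : ('I_n -> R) -> \bar R) (k : 'I_n -> R) :
  (forall s, (0 <= F s)%E) ->
  (iter_op (weighted_op (fun i t => (`|t| `^ (2 * k i))%R)) (F \o @psi R n) <=
   iter_op (weighted_op (fun i => half_line_powR (k i - 2^-1)%R)) F)%E.
Proof.
move=> F0; rewrite !iter_opE.
have -> : (fun _ => 0) = psi (fun _ : 'I_n => 0 : R) :> ('I_n -> R).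
  by apply/funext => i; rewrite /psi expr0n.
rewrite {1}(_ : psi (fun _ => 0) = (fun _ => 0)); last first.
  by apply/funext => i; rewrite /psi expr0n.
elim: (enum 'I_n) (fun _ : 'I_n => 0 : R) => //= i l IH s.
have f0 w l' s' : (forall i t, 0 <= w i t) -> (0 <= fold_op (weighted_op w) l' F s')%E.
  move=> w0; apply: fold_op_ge0 => // j h h0.
  by apply: integral_ge0 => u _; rewrite mule_ge0 ?lee_fin.
have H := @ge0_integral_comp_sqr_le R (k i) (fun t =>
  fold_op (weighted_op (fun i => half_line_powR (k i - 2^-1)%R)) l F (upd (psi s) i t)).
apply: le_trans (H _); last first.
  by move=> t; apply: f0 => j u; exact: half_line_powR_ge0.
apply: ge0_integral_le => t _.
  rewrite mule_ge0 ?lee_fin ?powR_ge0//; apply: fold_op_ge0 => [j h h0|j].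
    by apply: integral_ge0 => u _; rewrite mule_ge0 ?lee_fin ?powR_ge0.
  exact: F0.
rewrite lee_wpmul2r ?lee_fin ?powR_ge0//; apply: (le_trans (IH _)).
have -> // : psi (upd s i t) = upd (psi s) i (t ^+ 2).
by apply/funext => j; rewrite /psi /upd; case: ifP.
Qed.

Lemma intd_psi_le n (F : ('I_n -> R) -> \bar R) (k : 'I_n -> R) :
  (forall s, (0 <= F s)%E) ->
  (intd (fun y => F (psi y) * (\prod_i `|y i| `^ (2 * k i)%R)%:E) <=
   intd (fun z => F z * (\prod_i half_line_powR (k i - 2^-1)%R (z i))%:E))%E.
Proof.
move=> F0; rewrite (@intd_weights n F (fun i => half_line_powR (k i - 2^-1)))//; last first.
  by move=> i t; exact: half_line_powR_ge0.
rewrite (@intd_weights n (F \o @psi R n) (fun i t => `|t| `^ (2 * k i))) => [|s|i t].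
- exact: iter_op_psi_le.
- exact: F0.
- exact: powR_ge0.
Qed.



(** V evaluates g only at points (z_i t_i) with |t_i| ≤ 1, so a product majorant on the box |s_i| ≤
    |z_i| is enough, and V of a product factors. The invariant keeps the base point, initially 0,
    inside this box. *)
Lemma Vk_le_prod n (kappa z : 'I_n -> R) (g : ('I_n -> R) -> \bar R)
    (h : 'I_n -> R -> R) (c : 'I_n -> R) :
  (forall i t, 0 <= h i t) -> (forall i, 0 <= c i) ->
  (forall s, (0 <= g s)%E) ->
  (forall s, (forall i, `|s i| <= `|z i|) -> (g s <= (\prod_i h i (s i))%:E)%E) ->
  (forall i, (Vop1 (kappa i) (fun t => (h i (z i * t)%R)%:E) <= (c i)%:E)%E) ->
  (Vk kappa g z <= (\prod_i c i)%:E)%E.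
Proof.
move=> h0 c0 g0 gh hc.
pose ops (i : 'I_n) (h' : R -> \bar R) := Vop1 (kappa i) (fun t => h' (z i * t)).
rewrite /Vk iter_opE -/ops.
have ops0 i (h' : R -> \bar R) : (forall t, (0 <= h' t)%E) -> (0 <= ops i h')%E.
  by move=> h'0; apply: Vop1_ge0 => t _.
have P l s : uniq l -> (forall i, `|s i| <= `|z i|) ->
    (fold_op ops l g s <=
     (\prod_(j | j \notin l) h j (s j) * \prod_(j <- l) c j)%:E)%E.
  elim: l s => [|i l IH] s /= => [_ sz|/andP[il ul] sz].
    by rewrite big_nil mulr1; exact: gh.
  set K := \prod_(j | j \notin i :: l) h j (s j) * \prod_(j <- l) c j.
  have K0 : 0 <= K by rewrite mulr_ge0 ?prodr_ge0.
  apply: (@le_trans _ _ (Vop1 (kappa i) (fun t => K%:E * (h i (z i * t)%R)%:E))%E).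
    apply: le_Vop1 => t t1; first exact: fold_op_ge0.
    apply: (le_trans (IH _ ul _)) => [j|].
      rewrite /upd; case: ifP => [/eqP ->|//].
      by rewrite normrM ler_piMr// ler_norml.
    rewrite (@big_notin_upd _ _ _ n h l s i _ il) -EFinM lee_fin /K.
    by rewrite le_eqVlt; apply/orP; left; apply/eqP; rewrite /=; ring.
  rewrite Vop1Zl// => [|t _]; last by rewrite lee_fin.
  rewrite big_cons; apply: (@le_trans _ _ (K%:E * (c i)%:E)%E).
    by rewrite lee_wpmul2l ?lee_fin.
  by rewrite -EFinM lee_fin le_eqVlt; apply/orP; left; apply/eqP; rewrite /K; ring.
apply: (le_trans (P _ _ (enum_uniq _) _)) => [i|]; first by rewrite normr0.
by rewrite big_notin_enum mul1r big_enum.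
Qed.

Lemma Vk_ge_prod n (kappa z : 'I_n -> R) (g : ('I_n -> R) -> \bar R)
    (h : 'I_n -> R -> R) (c : 'I_n -> R) :
  (forall i t, 0 <= h i t) -> (forall i, 0 <= c i) ->
  (forall s, (0 <= g s)%E) ->
  (forall s, (forall i, `|s i| <= `|z i|) -> ((\prod_i h i (s i))%:E <= g s)%E) ->
  (forall i, ((c i)%:E <= Vop1 (kappa i) (fun t => (h i (z i * t)%R)%:E))%E) ->
  ((\prod_i c i)%:E <= Vk kappa g z)%E.
Proof.
move=> h0 c0 g0 gh hc.
pose ops (i : 'I_n) (h' : R -> \bar R) := Vop1 (kappa i) (fun t => h' (z i * t)).
rewrite /Vk iter_opE -/ops.
have P l s : uniq l -> (forall i, `|s i| <= `|z i|) ->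
    ((\prod_(j | j \notin l) h j (s j) * \prod_(j <- l) c j)%:E <=
     fold_op ops l g s)%E.
  elim: l s => [|i l IH] s /= => [_ sz|/andP[il ul] sz].
    by rewrite big_nil mulr1; exact: gh.
  set K := \prod_(j | j \notin i :: l) h j (s j) * \prod_(j <- l) c j.
  have K0 : 0 <= K by rewrite mulr_ge0 ?prodr_ge0.
  apply: (@le_trans _ _ (Vop1 (kappa i) (fun t => K%:E * (h i (z i * t)%R)%:E))%E); last first.
    apply: le_Vop1 => t t1; first by rewrite -EFinM lee_fin mulr_ge0.
    apply: (le_trans _ (IH _ ul _)) => [|j]; last first.
      rewrite /upd; case: ifP => [/eqP ->|//].
      by rewrite normrM ler_piMr// ler_norml.
    rewrite (@big_notin_upd _ _ _ n h l s i _ il) -EFinM lee_fin /K.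
    by rewrite le_eqVlt; apply/orP; left; apply/eqP; rewrite /=; ring.
  rewrite Vop1Zl// => [|t _]; last by rewrite lee_fin.
  rewrite big_cons; apply: (@le_trans _ _ (K%:E * (c i)%:E)%E); last first.
    by rewrite lee_wpmul2l ?lee_fin.
  by rewrite -EFinM lee_fin le_eqVlt; apply/orP; left; apply/eqP; rewrite /K; ring.
apply: (le_trans _ (P _ _ (enum_uniq _) _)) => [|i]; last by rewrite normr0.
by rewrite big_notin_enum mul1r big_enum.
Qed.

End IteratedOperators.

(** * Mass of products of windows on the simplex and on the ball *)

Section IteratedWindows.
Context {R : realType}.
Notation mu := (@lebesgue_measure R).

Definition cap_weight (k a th t : R) : R :=
  if (0 <= t) && (`|Num.sqrt t - a| <= th) then t `^ (k - 2^-1) else 0.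

Lemma cap_weight_ge0 k a th t : 0 <= cap_weight k a th t.
Proof. by rewrite /cap_weight; case: ifP => // _; exact: powR_ge0. Qed.

(** Write t^(k-1/2) = (√t)^(2k) t^(-1/2) with √t ≤ a + th. At t = 0 the window is 0, while the
    weight can be 0^0 = 1. *)
Lemma cap_weight_le (k a th t : R) : 0 <= k -> t != 0 ->
  cap_weight k a th t <= (a + th) `^ (2 * k) * sqrt_window a th t.
Proof.
move=> k0 t0; rewrite /cap_weight sqrt_windowE.
case: ifPn => [/andP[t1 ta]|_]; last first.
  by case: ifP => _; rewrite ?mulr0// mulr_ge0 ?powR_ge0.
have tp : 0 < t by rewrite lt_neqAle eq_sym t0.
rewrite tp ta/=.
have -> : k - 2^-1 = k + (2^-1 - 1) by field.
rewrite powRD; last by rewrite t0 implybT.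
rewrite ler_wpM2r ?powR_ge0//.
have -> : t `^ k = Num.sqrt t `^ (2 * k).
  by rewrite powRrM powR_mulrn ?sqrtr_ge0// sqr_sqrtr.
move: ta; rewrite ler_norml => /andP[_ ta].
have s0 := sqrtr_ge0 t.
by apply: ge0_ler_powR; rewrite ?nnegrE//; lra.
Qed.

(** Once the bounded factors (a_i+th)^(2k_i) are taken out, each integration merges one window with
    the window about the radius accumulated so far ([integral_two_sqrt_windows]). The half-width
    grows from (m+1)th to (m+2)th at the cost of a factor 8(m+2)th; the product of these factors is
    8^n (n+1)! th^n. At the end the radius is 1 and the remaining window is evaluated at 1. *)
Lemma intd_cap_weight_le n (k a : 'I_n -> R) (k' b th : R) :
  (forall i, 0 <= k i) -> 0 <= k' -> (forall i, 0 <= a i) -> 0 <= b -> 0 <= th ->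
  \sum_i a i ^+ 2 + b ^+ 2 = 1 ->
  (intd (fun y => (\prod_i cap_weight (k i) (a i) th (y i) *
                   cap_weight k' b th (1 - absv y))%:E) <=
   (8 ^+ n * (n.+1)`!%:R * th ^+ n *
    (\prod_i (a i + th) `^ (2 * k i) * (b + th) `^ (2 * k')))%:E)%E.
Proof.
move=> k0 k'0 a0 b0 th0 ab1; rewrite /intd iter_opE.
set I := (X in fold_op X); set g := (X in fold_op _ _ X).
pose rad (l : seq 'I_n) := Num.sqrt (\sum_(j <- l) a j ^+ 2 + b ^+ 2).
pose K (l : seq 'I_n) := \prod_(j <- l) (a j + th) `^ (2 * k j) *
  (b + th) `^ (2 * k') * (8 ^+ size l * (size l).+1`!%:R * th ^+ size l).
have K0 l : 0 <= K l.
  rewrite !mulr_ge0 ?powR_ge0 ?exprn_ge0//.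
  by apply: prodr_ge0 => j _; exact: powR_ge0.
have g0 s : (0 <= g s)%E.
  rewrite lee_fin mulr_ge0 ?cap_weight_ge0// prodr_ge0// => i _.
  exact: cap_weight_ge0.
have cw0 (l : seq 'I_n) (s : 'I_n -> R) :
    0 <= \prod_(j | j \notin l) cap_weight (k j) (a j) th (s j).
  by apply: prodr_ge0 => j _; exact: cap_weight_ge0.
have P l s : uniq l -> 1 - \sum_(j | j \notin l) s j != 0 ->
    (fold_op I l g s <= (\prod_(j | j \notin l) cap_weight (k j) (a j) th (s j) *
      (K l * sqrt_window (rad l) ((size l).+1%:R * th)
                         (1 - \sum_(j | j \notin l) s j)))%:E)%E.
  elim: l s => [|i l IH] s /= => [_ v0|/andP[il ul]].
    rewrite lee_fin; apply: ler_wpM2l; first exact: (cw0 [::] s).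
    rewrite /K /rad !big_nil add0r sqrtr_sqr ger0_norm// !mul1r !expr0 !mulr1.
    exact: cap_weight_le.
  set v := 1 - _ => v0.
  set C := \prod_(j | j \notin i :: l) cap_weight (k j) (a j) th (s j).
  set m := size l.
  pose D := C * K l * (a i + th) `^ (2 * k i).
  have C0 : 0 <= C by exact: cw0.
  have D0 : 0 <= D by rewrite mulr_ge0 ?powR_ge0// mulr_ge0.
  apply: (@le_trans _ _ (\int[mu]_t (D%:E * (sqrt_window (a i) th t *
      sqrt_window (rad l) (m.+1%:R * th)%R (v - t)%R)%:E))%E).
    (* The point t = 0 is excluded by [cap_weight_le], the point t = v by the induction hypothesis,
       which needs a nonzero remainder v - t. *)
    apply: (@ge0_integral_le_off_null _ _ R mu _ [set 0; v]) => //.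
    - exact: measurableU.
    - by apply: countable_lebesgue_measure0; apply: finite_set_countable;
         exact: finite_set2.
    - move=> t _; apply: fold_op_ge0 => // j h h0.
      exact: integral_ge0.
    - by move=> t _; rewrite mule_ge0 ?lee_fin// mulr_ge0 ?sqrt_window_ge0.
    move=> t _ /not_orP[/eqP t0 /eqP tv].
    have E : 1 - \sum_(j | j \notin l) upd s i t j = v - t.
      by rewrite (@big_notin_upd _ _ _ _ _ (fun _ x => x) l s i t il) /v/=; ring.
    apply: (le_trans (IH _ ul _)); first by rewrite E subr_eq0 eq_sym.
    rewrite E (@big_notin_upd _ _ _ _ _ (fun j => cap_weight (k j) (a j) th) l s i t il).
    rewrite -EFinM lee_fin /= -/C -/m /D.
    set W := sqrt_window (rad l) _ _.
    have W0 : 0 <= W by exact: sqrt_window_ge0.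
    have H := cap_weight_le (a i) th (k0 i) t0.
    have -> : cap_weight (k i) (a i) th t * C * (K l * W) =
        (C * K l * W) * cap_weight (k i) (a i) th t by ring.
    have -> : C * K l * (a i + th) `^ (2 * k i) * (sqrt_window (a i) th t * W) =
        (C * K l * W) * ((a i + th) `^ (2 * k i) * sqrt_window (a i) th t) by ring.
    by apply: ler_wpM2l => //; rewrite mulr_ge0// mulr_ge0.
  rewrite ge0_integralZl_nomeas//; last first.
    by move=> t _; rewrite lee_fin mulr_ge0 ?sqrt_window_ge0.
  have H := @integral_two_sqrt_windows R (a i) (rad l) th (m.+1%:R * th) v
    (a0 i) (sqrtr_ge0 _) th0 (mulr_ge0 (ler0n _ _) th0).
  apply: (le_trans (lee_wpmul2l _ H)); first by rewrite lee_fin.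
  have -> : Num.sqrt (a i ^+ 2 + rad l ^+ 2) = rad (i :: l).
    rewrite /rad sqr_sqrtr ?big_cons ?addrA// addr_ge0 ?sqr_ge0//.
    by apply: sumr_ge0 => j _; exact: sqr_ge0.
  have -> : th + m.+1%:R * th = m.+2%:R * th by rewrite -[m.+2]addn1 natrD; ring.
  rewrite -EFinM lee_fin le_eqVlt; apply/orP; left; apply/eqP.
  rewrite /D /K /= big_cons -/m !exprS [(m.+2)`!]factS natrM; ring.
have E1 : 1 - \sum_(j | j \notin enum 'I_n) (0 : R) = 1 by rewrite big1// subr0.
apply: (le_trans (P _ _ (enum_uniq _) _)); first by rewrite E1 oner_neq0.
rewrite lee_fin big_notin_enum mul1r E1 /K !big_enum size_enum_ord /=.
set A := \prod_(i | _) _; set B := (b + th) `^ _.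
have -> : rad (enum 'I_n) = 1 by rewrite /rad big_enum/= ab1 sqrtr1.
rewrite sqrt_windowE ltr01 sqrtr1 subrr normr0 mulr_ge0//= powR1 mulr1.
by rewrite mulrC.
Qed.

(** Each integration replaces the window about the accumulated radius by one 16 times narrower
    ([integral_circle_window_ge]) and yields that new width r/16^(m+1) as a factor, whence the
    product of the powers of 16. *)
Lemma intd_window_ge n (a : 'I_n -> R) (b r : R) :
  0 < r -> (forall i, r <= a i) -> r <= b -> \sum_i a i ^+ 2 + b ^+ 2 = 1 ->
  ((\prod_(j < n) 16 ^- j.+1 * r ^+ n)%:E <=
   intd (fun y => (\prod_i \1_(`[a i - r, a i + r]%classic : set R) (y i) *
                   sqrt_window b r (1 - norm2 y))%:E))%E.
Proof.
move=> r0 ra rb ab1; rewrite /intd iter_opE.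
set I := (X in fold_op X); set g := (X in fold_op _ _ X).
pose ind (j : 'I_n) : R -> R := \1_(`[a j - r, a j + r]%classic : set R).
pose rad (l : seq 'I_n) := Num.sqrt (\sum_(j <- l) a j ^+ 2 + b ^+ 2).
pose K (m : nat) : R := \prod_(j < m) 16 ^- j.+1 * r ^+ m.
have K0 m : 0 <= K m.
  apply: mulr_ge0; last by rewrite exprn_ge0// ltW.
  by apply: prodr_ge0 => j _; rewrite invr_ge0 exprn_ge0.
have i0 (l : seq 'I_n) (s : 'I_n -> R) : 0 <= \prod_(j | j \notin l) ind j (s j).
  by apply: prodr_ge0.
have P l s : uniq l ->
    ((\prod_(j | j \notin l) ind j (s j) *
      (K (size l) * sqrt_window (rad l) (r / 16 ^+ size l)
                         (1 - \sum_(j | j \notin l) s j ^+ 2)))%:E <=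
     fold_op I l g s)%E.
  elim: l s => [|i l IH] s /= => [_|/andP[il ul]].
    rewrite lee_fin le_eqVlt; apply/orP; left; apply/eqP.
    rewrite /K /rad big_ord0 big_nil add0r sqrtr_sqr ger0_norm; last by lra.
    by rewrite !expr0 !mul1r divr1.
  set v := 1 - _.
  set C := \prod_(j | j \notin i :: l) ind j (s j).
  set m := size l.
  pose D := C * K m.
  have C0 : 0 <= C by exact: i0.
  have D0 : 0 <= D by rewrite mulr_ge0.
  apply: (@le_trans _ _ (\int[mu]_t (D%:E * (ind i t *
      sqrt_window (rad l) (r / 16 ^+ m) (v - t ^+ 2))%R%:E))%E); last first.
    apply: ge0_integral_le => t _.
      by rewrite mule_ge0 ?lee_fin// mulr_ge0 ?sqrt_window_ge0.
    have E : 1 - \sum_(j | j \notin l) upd s i t j ^+ 2 = v - t ^+ 2.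
      by rewrite (@big_notin_upd _ _ _ _ _ (fun _ x => x ^+ 2) l s i t il) /v/=; ring.
    apply: (le_trans _ (IH _ ul)).
    rewrite E (@big_notin_upd _ _ _ _ _ ind l s i t il).
    rewrite -EFinM lee_fin /= -/C -/m /D le_eqVlt; apply/orP; left; apply/eqP.
    by rewrite mulrCA mulrA; ring.
  rewrite ge0_integralZl_nomeas//; last first.
    by move=> t _; rewrite lee_fin mulr_ge0 ?sqrt_window_ge0.
  have p16 : 0 < 16 ^+ m :> R by rewrite exprn_gt0.
  have rm0 : 0 < r / 16 ^+ m by rewrite divr_gt0.
  have rm : r / 16 ^+ m <= r.
    rewrite ler_pdivrMr//; apply: ler_peMr; first exact: ltW.
    by apply: exprn_ege1; rewrite ler1n.
  have radb : b <= rad l.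
    rewrite -[leLHS]ger0_norm; last by lra.
    rewrite -sqrtr_sqr ler_wsqrtr// lerDr.
    by apply: sumr_ge0 => j _; exact: sqr_ge0.
  have H := @integral_circle_window_ge R (a i) (rad l) (r / 16 ^+ m) r v
    rm0 (le_trans rm (ra i)) (le_trans rm (le_trans rb radb)) rm.
  apply: (le_trans _ (lee_wpmul2l _ H)); last by rewrite lee_fin.
  have -> : Num.sqrt (a i ^+ 2 + rad l ^+ 2) = rad (i :: l).
    rewrite /rad sqr_sqrtr ?big_cons ?addrA// addr_ge0 ?sqr_ge0//.
    by apply: sumr_ge0 => j _; exact: sqr_ge0.
  have -> : r / 16 ^+ m / 16 = r / 16 ^+ m.+1.
    by rewrite exprSr invfM mulrA.
  rewrite -EFinM lee_fin le_eqVlt; apply/orP; left; apply/eqP.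
  rewrite /D /K big_ord_recr/= [r ^+ m.+1]exprS; ring.
have E1 : 1 - \sum_(j | j \notin enum 'I_n) (0 : R) ^+ 2 = 1.
  by rewrite big1 ?subr0// => j _; rewrite expr0n.
apply: (le_trans _ (P _ _ (enum_uniq _))).
rewrite lee_fin big_notin_enum mul1r E1 size_enum_ord -/(K n).
have -> : rad (enum 'I_n) = 1 by rewrite /rad big_enum/= ab1 sqrtr1.
rewrite sqrt_windowE ltr01 sqrtr1 subrr normr0 divr_ge0 ?exprn_ge0//=; last exact: ltW.
by rewrite powR1 mulr1.
Qed.

End IteratedWindows.

(** * Spherical caps and the average of their indicators *)

Section CapGeometry.
Context {R : realType}.

Lemma sin_le_id (x : R) : 0 <= x -> sin x <= x.
Proof.
rewrite le_eqVlt => /predU1P[<-|x0]; first by rewrite sin0.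
have D (y : R) : y \in `]0, x[ -> is_derive y 1 sin (cos y) by move=> _; exact: is_derive_sin.
have C : {within `[0, x], continuous sin}.
  by apply: continuous_subspaceT; exact: continuous_sin.
have [c _] := MVT x0 D C; rewrite sin0 !subr0 => ->.
by rewrite ler_piMl ?cos_le1// ltW.
Qed.

(** On [0, 1] the mean value theorem gives the slope cos 1. Beyond 1 the sine is at least sin 1, and
    x ≤ π/2 < 2 costs the factor 1/2. *)
Lemma sin_ge_linear (x : R) : 0 <= x -> x <= pi / 2 -> cos 1 / 2 * x <= sin x.
Proof.
have c1 : 0 < cos 1 :> R by exact: cos1_gt0.
have [/andP[_ p4] _] := @pihalf_02_cos_pihalf R; have p2 := pi_ge2 R.
have small (y : R) : 0 <= y -> y <= 1 -> cos 1 * y <= sin y.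
  rewrite le_eqVlt => /predU1P[<- _|y0 y1]; first by rewrite sin0 mulr0.
  have D (z : R) : z \in `]0, y[ -> is_derive z 1 sin (cos z) by move=> _; exact: is_derive_sin.
  have C : {within `[0, y], continuous sin}.
    by apply: continuous_subspaceT; exact: continuous_sin.
  have [c] := MVT y0 D C; rewrite in_itv/= sin0 !subr0 => /andP[cy1 cy2] ->.
  rewrite ler_wpM2r ?ltW//.
  by rewrite ltr_cos ?in_itv/=; lra.
move=> x0 xp; have [x1|x1] := leP x 1.
  by apply: le_trans (small _ x0 x1); rewrite ler_wpM2r//; lra.
apply: (@le_trans _ _ (sin 1)); last first.
  by apply: ltW; rewrite ltr_sin ?in_itv/=; lra.
have := small 1 ler01 (lexx _); nra.
Qed.

Lemma one_sub_cos (x : R) : 1 - cos x = 2 * sin (x / 2) ^+ 2.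
Proof.
have {1}-> : x = (x / 2) *+ 2 by rewrite mulr2n; field.
by rewrite cos_mulr2n cos2sin2 mulr2n; ring.
Qed.

Lemma one_sub_cos_le (x : R) : 0 <= x -> x <= pi -> 1 - cos x <= x ^+ 2 / 2.
Proof.
move=> x0 xp; rewrite one_sub_cos.
have h : sin (x / 2) <= x / 2 by apply: sin_le_id; lra.
have h0 : 0 <= sin (x / 2) by apply: sin_ge0_pi; lra.
have := lerXn2r 2 (h0 : _ \is Num.nneg) (le_trans h0 h : _ \is Num.nneg) h.
rewrite !expr2; lra.
Qed.

(** The constant of the quadratic lower bound for 1 - cos x = 2 sin(x/2)^2 on [0, π], obtained by
    squaring [sin_ge_linear]. *)
Definition cos_gap : R := cos 1 ^+ 2 / 8.

Lemma cos_gap_gt0 : 0 < cos_gap.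
Proof. by rewrite divr_gt0// exprn_gt0// cos1_gt0. Qed.

Lemma cos_gap_le : cos_gap <= 8^-1.
Proof.
by rewrite ler_piMl// exprn_ile1 ?cos_le1// ltW// cos1_gt0.
Qed.

Lemma one_sub_cos_ge (x : R) : 0 <= x -> x <= pi -> cos_gap * x ^+ 2 <= 1 - cos x.
Proof.
move=> x0 xp; rewrite one_sub_cos.
have c1 : 0 < cos 1 :> R by exact: cos1_gt0.
have h : cos 1 / 2 * (x / 2) <= sin (x / 2) by apply: sin_ge_linear; lra.
have h0 : 0 <= cos 1 / 2 * (x / 2) by rewrite !mulr_ge0 ?invr_ge0//; exact: ltW.
have := lerXn2r 2 (h0 : _ \is Num.nneg) (le_trans h0 h : _ \is Num.nneg) h.
rewrite /cos_gap !expr2; lra.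
Qed.

Section UnitVectors.
Variables (m : nat) (X Y : 'I_m -> R).
Hypotheses (X1 : norm2 X = 1) (Y1 : norm2 Y = 1).

Lemma norm2B_unit : \sum_i (X i - Y i) ^+ 2 = 2 - 2 * inner X Y.
Proof.
transitivity (norm2 X + norm2 Y - 2 * inner X Y); last by rewrite X1 Y1.
rewrite /norm2 /inner mulr_sumr -big_split -sumrB/=.
by apply: eq_bigr => i _; ring.
Qed.

Lemma inner_unit_le1 : inner X Y <= 1.
Proof.
have : 0 <= \sum_i (X i - Y i) ^+ 2 by apply: sumr_ge0 => i _; exact: sqr_ge0.
rewrite norm2B_unit; lra.
Qed.

(** For unit vectors |X-Y|^2 = 2(1 - ⟨X,Y⟩) ≤ 2(1 - cos th) ≤ th^2. *)
Lemma unit_coord_dist_le (th : R) : 0 <= th -> th <= pi ->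
  cos th <= inner X Y -> forall i, `|X i - Y i| <= th.
Proof.
move=> th0 thp hc i.
have H : (X i - Y i) ^+ 2 <= th ^+ 2.
  apply: (@le_trans _ _ (\sum_i (X i - Y i) ^+ 2)).
    by rewrite (bigD1 i)//= lerDl; apply: sumr_ge0 => j _; exact: sqr_ge0.
  by rewrite norm2B_unit; have := one_sub_cos_le th0 thp; lra.
rewrite -[leRHS]ger0_norm// -(@ler_pXn2r _ 2) ?nnegrE//.
by rewrite -!normrX !ger0_norm ?sqr_ge0.
Qed.

End UnitVectors.

Lemma acos_le (th S : R) : 0 <= th -> th <= pi -> -1 <= S -> S <= 1 ->
  (acos S <= th) = (cos th <= S).
Proof.
move=> th0 thp S1 S2.
have SS : -1 <= S <= 1 by rewrite S1.
rewrite -[in RHS](@acosK _ S) ?in_itv//= !leNgt ltr_cos// ?in_itv/= ?th0//.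
by rewrite acos_ge0// acos_lepi.
Qed.

(* [cap_ratio a th] is comparable to the square of [th / max (a, th)], the
   opening in the variable t at which the cap is seen by the V-average. *)
Definition cap_ratio (a th : R) : R := (th / (a + th)) ^+ 2.

Lemma cap_ratio_gt0 a th : 0 <= a -> 0 < th -> 0 < cap_ratio a th.
Proof. by move=> a0 th0; rewrite exprn_gt0// divr_gt0//; lra. Qed.

Lemma cap_ratio_le1 a th : 0 <= a -> 0 < th -> cap_ratio a th <= 1.
Proof.
move=> a0 th0; rewrite exprn_ile1// ?divr_ge0//; [lra|lra|].
by rewrite ler_pdivrMr; lra.
Qed.

Lemma cap_ratio_powR a th k : 0 <= a -> 0 < th ->
  cap_ratio a th `^ k = th `^ (2 * k) / (a + th) `^ (2 * k).
Proof.
move=> a0 th0; have d0 : 0 <= th / (a + th) by rewrite divr_ge0//; lra.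
rewrite /cap_ratio -(powR_mulrn 2 d0) -powRrM powRM ?invr_ge0; [|lra|lra].
congr (_ * _); rewrite -(@powR_inv1 _ (a + th)); last by lra.
by rewrite -powRrM mulN1r powRN.
Qed.

(** If a ≤ 2 th the ratio is at least 1/9 and the bound is trivial. Otherwise |z| ≥ a/2, so a^2
    (1-|t|) ≤ th^2, and a + th is comparable to a. *)
Lemma cap_opening_le (a z th t : R) : 0 <= a -> 0 < th -> `|a - `|z| | <= th ->
  a * (`|z| - z * t) <= th ^+ 2 / 2 -> 1 - `|t| <= 9 * cap_ratio a th.
Proof.
move=> a0 th0; rewrite ler_norml => /andP[az1 az2] H.
have ath : 0 < a + th by lra.
have t0 := normr_ge0 t.
rewrite /cap_ratio expr_div_n mulrA ler_pdivlMr ?exprn_gt0//.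
have H2 : a * `|z| * (1 - `|t|) <= th ^+ 2 / 2.
  apply: le_trans H; rewrite -mulrA ler_wpM2l//.
  by have := ler_norm (z * t); rewrite normrM; lra.
have [t1|t1] := leP (1 - `|t|) 0.
  apply: (@le_trans _ _ 0); first by rewrite mulr_le0_ge0// exprn_ge0// ltW.
  by rewrite mulr_ge0// exprn_ge0// ltW.
have [a2|a2] := leP a (2 * th).
  apply: (@le_trans _ _ ((a + th) ^+ 2)).
    by rewrite ler_piMl ?sqr_ge0//; lra.
  have : (a + th) ^+ 2 <= (3 * th) ^+ 2 by rewrite lerXn2r ?nnegrE//; lra.
  by rewrite exprMn; lra.
have h1 : a * (a / 2) <= a * `|z| by rewrite ler_wpM2l//; lra.
have h2 : a * (a / 2) * (1 - `|t|) <= th ^+ 2 / 2.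
  by apply: le_trans H2; rewrite ler_wpM2r// ltW.
have h3 : (a + th) ^+ 2 <= (2 * a) ^+ 2 by rewrite lerXn2r ?nnegrE//; lra.
apply: (@le_trans _ _ ((1 - `|t|) * (2 * a) ^+ 2)).
  by rewrite ler_wpM2l// ltW.
have := sqr_ge0 th; rewrite !expr2 in h2 h3 *; lra.
Qed.

(** On the box |u_i| ≤ |z_i| one has ⟨X,u⟩ ≤ ⟨X,|z|⟩ ≤ 1. So g vanishes there unless |z| is in the
    cap, and if u is in the cap each nonnegative term X_i(|z_i| - u_i) is at most 1 - cos th ≤
    th^2/2. The cap indicator is thus dominated by a product of one-variable indicators, to which
    [cap_opening_le] applies. *)
Lemma Vk_cap_le m (kappa : 'I_m -> R) : (0 < m)%N -> (forall i, 0 <= kappa i) ->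
  exists2 C : R, 0 < C & forall (X z : 'I_m -> R) (th : R) (g : ('I_m -> R) -> \bar R),
  (forall i, 0 <= X i) -> norm2 X = 1 -> norm2 z = 1 -> 0 < th -> th <= pi ->
  (forall u, (0 <= g u)%E) -> (forall u, (g u <= (cos th <= inner X u)%R%:R%:E)%E) ->
  (Vk kappa g z <= (C * \prod_i cap_ratio (X i) th `^ kappa i *
                    (cos th <= inner X (fun i => `|z i|))%R%:R)%:E)%E.
Proof.
move=> m0 k0.
have /choice [C HC] : forall i, exists C : R, 0 < C /\ forall del : R, 0 < del ->
    (Vop1 (kappa i) (fun t => (\1_[set t : R | 1 - `|t| <= del] t)%:E) <=
     (C * del `^ kappa i)%:E)%E.
  by move=> i; have [C C0 HC] := Vop1_le_powR (k0 i); exists C.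
exists (\prod_i (C i * 9 `^ kappa i)).
  by apply: prodr_gt0 => i _; rewrite mulr_gt0 ?powR_gt0//; case: (HC i).
move=> X z th g X0 X1 z1 th0 thp g0 gle.
have dom u : (forall i, `|u i| <= `|z i|) ->
    inner X u <= inner X (fun i => `|z i|).
  move=> uz; apply: ler_sum => i _; rewrite ler_wpM2l//.
  exact: le_trans (ler_norm _) (uz i).
have z'1 : norm2 (fun i => `|z i|) = 1.
  by rewrite -z1; apply: eq_bigr => i _; rewrite real_normK ?num_real.
case: (boolP (cos th <= inner X (fun i => `|z i|))) => hz; last first.
  (* Writing 0 as a product of zeros requires at least one factor, hence 0 < m. *)
  rewrite mulr0; have -> : 0%R = \prod_(i < m) (0 : R).
    by case: m m0 {kappa k0 C HC X z g X0 X1 z1 g0 gle dom z'1 hz} => // m _;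
       rewrite big_ord_recl mul0r.
  apply: (@Vk_le_prod _ _ _ _ _ (fun _ _ => 0)) => //.
  - move=> u uz; apply: (le_trans (gle u)); rewrite lee_fin.
    case: (boolP (cos th <= inner X u)) => // hu.
      by move/negP: hz; case; exact: le_trans hu (dom u uz).
    by apply: prodr_ge0.
  - move=> i; rewrite /Vop1; case: ifP => _; first by rewrite adde0 mul0e.
    by rewrite integral0_eq ?mule0// => t _; rewrite mul0e.
rewrite mulr1 -big_split/=.
apply: (@le_trans _ _ (\prod_i (C i * (9 * cap_ratio (X i) th) `^ kappa i))%:E); last first.
  rewrite lee_fin le_eqVlt; apply/orP; left; apply/eqP; apply: eq_bigr => i _.
  by rewrite powRM// ?mulrA// ltW// cap_ratio_gt0.
pose h i : R -> R := \1_[set t : R | X i * (`|z i| - t) <= th ^+ 2 / 2].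
have q0 i : 0 < 9 * cap_ratio (X i) th by rewrite mulr_gt0// cap_ratio_gt0.
apply: (@Vk_le_prod _ _ _ _ _ h) => //.
- by move=> i; rewrite mulr_ge0 ?powR_ge0//; case: (HC i) => /ltW.
- move=> u uz; apply: (le_trans (gle u)); rewrite lee_fin.
  case: (boolP (cos th <= inner X u)) => [hu|_]; last by rewrite prodr_ge0.
  rewrite big1// => i _; rewrite /h indicE mem_set//=.
  apply: (@le_trans _ _ (1 - cos th)); last first.
    exact: one_sub_cos_le (ltW th0) thp.
  have H : X i * (`|z i| - u i) <= inner X (fun i => `|z i|) - inner X u.
    rewrite /inner -sumrB (bigD1 i)//= -mulrBr lerDl; apply: sumr_ge0 => j _.
    rewrite -mulrBr mulr_ge0// subr_ge0.
    exact: le_trans (ler_norm _) (uz j).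
  have := inner_unit_le1 X1 z'1; lra.
- move=> i; have [_ Hi] := HC i; apply: (le_trans _ (Hi _ (q0 i))).
  apply: le_Vop1 => t _; first by rewrite lee_fin.
  rewrite lee_fin /h !indicE ler_nat.
  case: (boolP (_ \in [set t | X i * _ <= _])) => //; rewrite inE/= => H.
  rewrite mem_set//=; apply: (cap_opening_le (X0 i) th0 _ H).
  exact: (unit_coord_dist_le X1 z'1 (ltW th0) thp hz i).
Qed.

Lemma Vk_cap_ge m (kappa : 'I_m -> R) : (forall i, 0 <= kappa i) ->
  exists2 c : R, 0 < c & forall (X z : 'I_m -> R) (th e : R) (g : ('I_m -> R) -> \bar R),
  (forall i, 0 <= X i) -> (forall i, 0 <= z i) -> 0 < th -> 0 < e -> e <= 1 ->
  (forall u, (0 <= g u)%E) ->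
  (forall u, (forall i, `|u i| <= z i) ->
     (forall i, z i * (1 - e * cap_ratio (X i) th) <= u i) -> (1 <= g u)%E) ->
  ((c * \prod_i (e * cap_ratio (X i) th) `^ kappa i)%:E <= Vk kappa g z)%E.
Proof.
move=> k0.
have /choice [c Hc] : forall i, exists c : R, 0 < c /\ forall del : R, 0 < del -> del <= 1 ->
    ((c * del `^ kappa i)%:E <=
     Vop1 (kappa i) (fun t => (\1_[set t : R | 1 - del <= t] t)%:E))%E.
  by move=> i; have [c c0 Hc] := Vop1_ge_powR (k0 i); exists c.
exists (\prod_i c i); first by apply: prodr_gt0 => i _; case: (Hc i).
move=> X z th e g X0 z0 th0 e0 e1 g0 gge.
rewrite -big_split/=.
pose h i : R -> R := \1_[set t : R | z i * (1 - e * cap_ratio (X i) th) <= t].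
have q0 i : 0 < e * cap_ratio (X i) th by rewrite mulr_gt0// cap_ratio_gt0.
have q1 i : e * cap_ratio (X i) th <= 1.
  by rewrite mulr_ile1// ?cap_ratio_le1// ltW// cap_ratio_gt0.
apply: (@Vk_ge_prod _ _ _ _ _ h) => //.
- by move=> i; rewrite mulr_ge0 ?powR_ge0//; case: (Hc i) => /ltW.
- move=> u uz.
  have [H|H] := pselect (forall i, z i * (1 - e * cap_ratio (X i) th) <= u i).
    apply: (@le_trans _ _ 1%E); last by apply: gge => // i; have := uz i; rewrite (ger0_norm (z0 i)).
    rewrite lee_fin; apply: prodr_ile1 => i _; rewrite /h indicE.
    by case: (_ \in _); rewrite ?lexx ?ler01.
  move/existsNP: H => [i Hi]; apply: (le_trans _ (g0 u)); rewrite lee_fin.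
  by rewrite (bigD1 i)//= /h indicE memNset// mul0r.
- move=> i; have [_ Hi] := Hc i; apply: (le_trans (Hi _ (q0 i) (q1 i))).
  apply: le_Vop1 => t _; first by rewrite lee_fin.
  rewrite lee_fin /h !indicE ler_nat.
  case: (boolP (_ \in [set t | 1 - _ <= t])) => //; rewrite inE/= => H.
  by rewrite mem_set//= ler_wpM2l.
Qed.

End CapGeometry.

(** * Numerator on the ball and denominator on the simplex, from above *)

Section SimplexAndBall.
Context {R : realType}.
Variables (d : nat) (kappa : 'I_d.+1 -> R).
Hypothesis kappa0 : forall i, 0 <= kappa i.

(* The lift of a point of the simplex to the unit sphere of R^(d+1), through
   coordinatewise square roots. *)
Definition sphere_lift (x : 'I_d -> R) : 'I_d.+1 -> R :=
  Yof (fun i => Num.sqrt (x i)).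

Lemma big_ord_lift_max (T : Type) (idx : T) (op : Monoid.com_law idx)
    (F : 'I_d.+1 -> T) :
  \big[op/idx]_j F j = op (\big[op/idx]_i F (lift ord_max i)) (F ord_max).
Proof. by rewrite (@bigD1_ord _ _ _ _ ord_max)//= Monoid.mulmC. Qed.

Lemma ext_max (y : 'I_d -> R) t : ext y t ord_max = t.
Proof. by rewrite /ext unlift_none. Qed.

Lemma ext_lift (y : 'I_d -> R) t i : ext y t (lift ord_max i) = y i.
Proof. by rewrite /ext liftK. Qed.

Lemma fst_ext (y : 'I_d -> R) t : fst_d (ext y t) = y.
Proof. by apply/funext => i; rewrite /fst_d ext_lift. Qed.

Lemma norm2_ge0 n (y : 'I_n -> R) : 0 <= norm2 y.
Proof. by apply: sumr_ge0 => i _; exact: sqr_ge0. Qed.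

Lemma norm2_ext (y : 'I_d -> R) t : norm2 (ext y t) = norm2 y + t ^+ 2.
Proof.
rewrite /norm2 big_ord_lift_max/= ext_max; congr (_ + _).
by apply: eq_bigr => i _; rewrite ext_lift.
Qed.

Lemma norm2_Yof (y : 'I_d -> R) : norm2 y <= 1 -> norm2 (Yof y) = 1.
Proof. by move=> y1; rewrite norm2_ext sqr_sqrtr ?subr_ge0//; ring. Qed.

Lemma inner_Yof (y : 'I_d -> R) w :
  inner (Yof y) w = inner y (fst_d w) + Num.sqrt (1 - norm2 y) * lst_d w.
Proof.
rewrite /inner /Yof big_ord_lift_max/= ext_max; congr (_ + _).
by apply: eq_bigr => i _; rewrite ext_lift.
Qed.

Lemma norm2_sqrt (x : 'I_d -> R) : (forall i, 0 <= x i) ->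
  norm2 (fun i => Num.sqrt (x i)) = absv x.
Proof. by move=> x0; apply: eq_bigr => i _; rewrite sqr_sqrtr. Qed.

Lemma sphere_lift_ge0 x j : 0 <= sphere_lift x j.
Proof. by rewrite /sphere_lift /Yof /ext; case: unlift => [i|]; exact: sqrtr_ge0. Qed.

Lemma norm2_sphere_lift x : Tsimplex d x -> norm2 (sphere_lift x) = 1.
Proof. by move=> [x0 x1]; apply: norm2_Yof; rewrite norm2_sqrt. Qed.

Lemma sphere_lift_max x : Tsimplex d x ->
  sphere_lift x ord_max = Num.sqrt (1 - absv x).
Proof. by move=> [x0 x1]; rewrite /sphere_lift /Yof ext_max norm2_sqrt. Qed.

Lemma sphere_lift_lift x i : sphere_lift x (lift ord_max i) = Num.sqrt (x i).
Proof. exact: ext_lift. Qed.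

Lemma dTE x y : Tsimplex d x -> Tsimplex d y ->
  dT x y = acos (inner (sphere_lift x) (sphere_lift y)).
Proof.
move=> Tx Ty; rewrite /dT /inner big_ord_lift_max/= !sphere_lift_max//.
congr (acos (_ + _)); apply: eq_bigr => i _.
by rewrite !sphere_lift_lift sqrtrM//; case: Tx.
Qed.

Lemma dT_le x y th : Tsimplex d x -> Tsimplex d y -> 0 <= th -> th <= pi ->
  (dT x y <= th) = (cos th <= inner (sphere_lift x) (sphere_lift y)).
Proof.
move=> Tx Ty th0 thp; rewrite dTE// acos_le//; last first.
  by apply: inner_unit_le1; exact: norm2_sphere_lift.
apply: (@le_trans _ _ 0) => //.
by apply: sumr_ge0 => i _; rewrite mulr_ge0 ?sphere_lift_ge0.
Qed.

Lemma psi_Tsimplex (y : 'I_d -> R) : Bball d y -> Tsimplex d (psi y).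
Proof. by move=> y1; split => // i; exact: sqr_ge0. Qed.

(** This turns the condition on |z| in [Vk_cap_le] into d_T(x, ψ(y)) ≤ θ. *)
Lemma sphere_lift_psi (y : 'I_d -> R) : sphere_lift (psi y) = fun j => `|Yof y j|.
Proof.
apply/funext => j; case: (unliftP ord_max j) => [i ->|->].
  by rewrite sphere_lift_lift /Yof ext_lift sqrtr_sqr.
rewrite /sphere_lift /Yof !ext_max ger0_norm ?sqrtr_ge0//.
congr (Num.sqrt (1 - _)); apply: eq_bigr => i _.
by rewrite sqr_sqrtr// /psi sqr_ge0.
Qed.

Lemma Vk_ge0 n (k : 'I_n -> R) g z : (forall u, (0 <= g u)%E) -> (0 <= Vk k g z)%E.
Proof.
by move=> g0; apply: fold_op_ge0 => // i h h0; apply: Vop1_ge0 => t _; exact: h0.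
Qed.

Lemma VBk_ge0 (g : ('I_d.+1 -> R) -> \bar R) w :
  (forall u, (0 <= g u)%E) -> (0 <= VBk kappa g w)%E.
Proof. by move=> g0; rewrite mule_ge0 ?lee_fin ?invr_ge0// adde_ge0// Vk_ge0. Qed.

Let cap (x : 'I_d -> R) (th : R) : ('I_d.+1 -> R) -> \bar R :=
  fun w => (\1_(ecap (fun i => Num.sqrt (x i)) th) w)%:E.

Let cap_ge0 x th w : (0 <= cap x th w)%E.
Proof. by rewrite lee_fin. Qed.

Lemma VBk_cap_le : exists2 C : R, 0 < C &
  forall (x y : 'I_d -> R) (th : R), Tsimplex d x -> Bball d y ->
    0 < th -> th <= pi ->
  (VBk kappa (cap x th) (Yof y) <=
   (C * \prod_j cap_ratio (sphere_lift x j) th `^ kappa j *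
    (dT x (psi y) <= th)%R%:R)%:E)%E.
Proof.
have [C C0 HC] := @Vk_cap_le R d.+1 kappa isT kappa0.
exists C => // x y th Tx By th0 thp.
have cap_le u : (cap x th u <= (cos th <= inner (sphere_lift x) u)%R%:R%:E)%E.
  rewrite lee_fin indicE ler_nat; case: (boolP (_ \in _)) => //.
  by rewrite inE => -[_ [H _]]; rewrite inner_Yof H.
have H z : norm2 z = 1 -> (fun j => `|z j|) = sphere_lift (psi y) ->
    (Vk kappa (cap x th) z <=
   (C * \prod_j cap_ratio (sphere_lift x j) th `^ kappa j *
    (dT x (psi y) <= th)%R%:R)%:E)%E.
  move=> z1 zE; rewrite dT_le ?(ltW th0)//; last exact: psi_Tsimplex.
  rewrite -zE; apply: HC => //; first by move=> i; exact: sphere_lift_ge0.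
  exact: norm2_sphere_lift.
rewrite /VBk; set B := (X in (_ <= X)%E).
(* Y(y) and its reflection in the last coordinate have the same absolute values, so each half of V^B
   satisfies the same bound. *)
have -> : B = ((B + B) * (2^-1)%:E)%E.
  by rewrite /B -EFinD -EFinM; congr EFin; field.
rewrite lee_wpmul2r ?lee_fin ?invr_ge0// leeD//; apply: H.
- exact: norm2_Yof.
- by rewrite sphere_lift_psi.
- by rewrite /Yof fst_ext norm2_ext sqrrN /lst_d ext_max -norm2_ext norm2_Yof.
rewrite sphere_lift_psi; apply/funext => j; case: (unliftP ord_max j) => [i ->|->].
  by rewrite /Yof !ext_lift /fst_d ext_lift.
by rewrite /Yof /lst_d !ext_max normrN.
Qed.

(** On the d_T-ball every coordinate of the lift is within th of that of x, so the ball lies in a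
    product of windows and [intd_cap_weight_le] applies. *)
Lemma MT_denominator_le (x : 'I_d -> R) (th : R) :
  Tsimplex d x -> 0 < th -> th <= pi ->
  (intd (fun y => (\1_(@Tsimplex R d `&` [set y | (dT x y <= th)%R]) y)%:E *
                  (WT kappa y)%:E) <=
   (8 ^+ d * (d.+1)`!%:R * th ^+ d *
    \prod_j (sphere_lift x j + th) `^ (2 * kappa j))%:E)%E.
Proof.
move=> Tx th0 thp.
have [x0 x1] := Tx.
rewrite big_ord_lift_max/= sphere_lift_max//.
under [X in (_ <= (_ * (X * _))%:E)%E]eq_bigr do rewrite sphere_lift_lift.
have W0 y : 0 <= WT kappa y.
  by rewrite mulr_ge0 ?powR_ge0//; apply: prodr_ge0 => i _; exact: powR_ge0.
apply: le_trans (@intd_cap_weight_le R d (fun i => kappa (lift ord_max i))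
  (fun i => Num.sqrt (x i)) (kappa ord_max) (Num.sqrt (1 - absv x)) th
  _ _ _ _ _ _) => //.
- apply: le_intd => [y|y]; first by rewrite mule_ge0 ?lee_fin.
  rewrite -EFinM lee_fin indicE; case: (boolP (_ \in _)) => [|_]; last first.
    rewrite mul0r mulr_ge0 ?cap_weight_ge0//.
    by apply: prodr_ge0 => i _; exact: cap_weight_ge0.
  rewrite inE/= => -[Ty]; have [y0 y1] := Ty; rewrite dT_le ?(ltW th0)// => hc.
  have H := unit_coord_dist_le (norm2_sphere_lift Tx) (norm2_sphere_lift Ty)
    (ltW th0) thp hc.
  rewrite mul1r /WT le_eqVlt; apply/orP; left; apply/eqP; congr (_ * _).
    apply: eq_bigr => i _; rewrite /cap_weight y0/= ifT//.
    by have := H (lift ord_max i); rewrite !sphere_lift_lift distrC.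
  rewrite /cap_weight subr_ge0 y1/= ifT//.
  by have := H ord_max; rewrite !sphere_lift_max// distrC.
- exact: ltW.
- rewrite sqr_sqrtr ?subr_ge0//.
  by under eq_bigr do rewrite sqr_sqrtr//; rewrite addrC subrK.
Qed.

Lemma MB_numerator_le : exists2 C : R, 0 < C &
  forall (f : ('I_d -> R) -> R) (x : 'I_d -> R) (th : R), Tsimplex d x ->
    0 < th -> th <= pi ->
  (intd (fun y => (\1_(@Bball R d) y)%:E * (`|f (psi y)|)%:E *
      VBk kappa (cap x th) (Yof y) * (WB kappa y)%:E) <=
   (C * \prod_j cap_ratio (sphere_lift x j) th `^ kappa j)%:E *
   intd (fun y => (\1_(@Tsimplex R d `&` [set y | (dT x y <= th)%R]) y)%:E *
                  (`|f y| * WT kappa y)%:E))%E.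
Proof.
have [C C0 HC] := VBk_cap_le.
exists C => // f x th Tx th0 thp.
set K := C * _.
have K0 : 0 <= K.
  by rewrite mulr_ge0 ?(ltW C0)//; apply: prodr_ge0 => j _; exact: powR_ge0.
pose A := @Tsimplex R d `&` [set y | dT x y <= th].
have W0 y : 0 <= WT kappa y.
  by rewrite mulr_ge0 ?powR_ge0//; apply: prodr_ge0 => i _; exact: powR_ge0.
have W'0 y : 0 <= WB kappa y.
  by rewrite mulr_ge0 ?powR_ge0//; apply: prodr_ge0 => i _; exact: powR_ge0.
(* Since ‖y‖^2 = |ψ(y)|, everything in the bounded integrand except ∏ |y_i|^(2κ_i) is a function F
   of ψ(y), as [intd_psi_le] requires. *)
pose F (z : 'I_d -> R) : \bar R :=
  (K * (\1_A z * (`|f z| * (1 - absv z) `^ (kappa ord_max - 2^-1))))%:E.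
have F0 z : (0 <= F z)%E 
  by rewrite lee_fin mulr_ge0// mulr_ge0// mulr_ge0// powR_ge0.
rewrite -intdZl//; last first.
  by move=> y; apply: mule_ge0; rewrite lee_fin// mulr_ge0.
apply: (@le_trans _ _ (intd (fun y => F (psi y) *
    (\prod_i `|y i| `^ (2 * kappa (lift ord_max i))%R)%:E))%E).
  apply: le_intd => y.
    apply: mule_ge0; last by rewrite lee_fin.
    apply: mule_ge0; last exact: VBk_ge0.
    by apply: mule_ge0; rewrite lee_fin.
  have [By|By] := pselect (Bball d y); last first.
    rewrite indicE memNset// !mul0e mule_ge0// lee_fin.
    by apply: prodr_ge0 => i _; exact: powR_ge0.
  rewrite indicE mem_set// mul1e.
  apply: (@le_trans _ _ ((`|f (psi y)|)%:E *
      (K * (dT x (psi y) <= th)%R%:R)%:E * (WB kappa y)%:E)%E).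
    by rewrite lee_wpmul2r ?lee_fin// lee_wpmul2l ?lee_fin// HC.
  rewrite -!EFinM lee_fin /WB /F indicE.
  have -> : (psi y \in A) = (dT x (psi y) <= th).
    apply/idP/idP; first by rewrite inE => -[].
    by move=> h; rewrite inE; split => //; exact: psi_Tsimplex.
  rewrite (_ : absv (psi y) = norm2 y)//.
  by rewrite le_eqVlt; apply/orP; left; apply/eqP; ring.
apply: (le_trans (intd_psi_le _ F0)); apply: le_intd => z.
  rewrite mule_ge0// lee_fin; apply: prodr_ge0 => i _; exact: half_line_powR_ge0.
rewrite /F -!EFinM lee_fin -/A indicE; case: (boolP (z \in A)) => [|_]; last first.
  by rewrite !mul0r !mulr0 mul0r.
rewrite inE => -[[z0 _] _]; rewrite !mul1r /WT.
have -> : \prod_i half_line_powR (kappa (lift ord_max i) - 2^-1) (z i) =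
    \prod_i z i `^ (kappa (lift ord_max i) - 2^-1).
  by apply: eq_bigr => i _; rewrite /half_line_powR z0.
by rewrite le_eqVlt; apply/orP; left; apply/eqP; ring.
Qed.

End SimplexAndBall.

(** * Lower bound for the denominator on the ball *)

Section DenominatorLowerBound.
Context {R : realType}.
Variables (d : nat) (kappa : 'I_d.+1 -> R).
Hypothesis kappa0 : forall i, 0 <= kappa i.

(* Moving a unit vector X by e into the open positive orthant: the coordinates
   of the new unit vector are sqrt ((X_j^2 + e^2) / (1 + M e^2)), where M is the
   number of coordinates. *)
Definition push_inside (M e a : R) : R :=
  Num.sqrt ((a ^+ 2 + e ^+ 2) / (1 + M * e ^+ 2)).

(** The normalizing denominator lies in [1, 2], and 2(a^2+e^2) ≥ (a+e)^2 gives the lower bound. *)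
Lemma push_insideP (M e a : R) : 1 <= M -> 0 < e -> M * e <= 1 -> 0 <= a -> a <= 1 ->
  (a + e) / 2 <= push_inside M e a /\ `|push_inside M e a - a| <= e.
Proof.
move=> M1 e0 Me a0 a1; rewrite /push_inside.
have e1 : e <= 1 by apply: le_trans Me; rewrite ler_peMl// ltW.
have ee : M * e ^+ 2 <= 1.
  by rewrite expr2 mulrA; apply: le_trans Me; rewrite ler_piMr// mulr_ge0; lra.
have ee0 : 0 <= M * e ^+ 2 by rewrite mulr_ge0 ?sqr_ge0//; lra.
have D0 : 0 < 1 + M * e ^+ 2 by lra.
have a20 := sqr_ge0 a; have e20 := sqr_ge0 e.
split.
  rewrite -[leLHS]ger0_norm; last by rewrite divr_ge0//; lra.
  rewrite -sqrtr_sqr ler_wsqrtr// ler_pdivlMr// exprMn.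
  apply: (@le_trans _ _ ((a + e) ^+ 2 * 2^-1 ^+ 2 * 2)).
    by rewrite ler_wpM2l ?mulr_ge0 ?sqr_ge0//; lra.
  have := sqr_ge0 (a - e); rewrite !expr2; lra.
rewrite ler_norml; apply/andP; split; last first.
  rewrite lerBlDr -[leRHS]ger0_norm; last by lra.
  rewrite -sqrtr_sqr ler_wsqrtr// ler_pdivrMr//.
  apply: (@le_trans _ _ ((e + a) ^+ 2)).
    by rewrite sqrrD; have := mulr_ge0 (ltW e0) a0; lra.
  by rewrite ler_peMr ?sqr_ge0//; lra.
rewrite lerBrDr; have [ae|ae] := leP (- e + a) 0.
  by apply: (le_trans ae); exact: sqrtr_ge0.
rewrite -[leLHS]ger0_norm; last exact: ltW.
rewrite -sqrtr_sqr ler_wsqrtr// ler_pdivlMr// mulrDr mulr1.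
have h1 : (- e + a) ^+ 2 <= a ^+ 2 by rewrite lerXn2r ?nnegrE//; lra.
have h2 : a ^+ 2 <= a by rewrite expr2 ler_piMl.
have h3 : (- e + a) ^+ 2 * (M * e ^+ 2) <= a * e.
  apply: (@le_trans _ _ (a * (M * e ^+ 2))); first by rewrite ler_wpM2r//; lra.
  by rewrite ler_wpM2l// expr2 mulrA ler_piMl// ltW.
have := mulr_ge0 a0 (ltW e0); rewrite sqrrD; lra.
Qed.

Lemma sum_push_inside (e : R) (X : 'I_d.+1 -> R) : norm2 X = 1 ->
  norm2 (fun j => push_inside d.+1%:R e (X j)) = 1.
Proof.
move=> X1; have D0 : 0 < 1 + d.+1%:R * e ^+ 2 :> R.
  by rewrite ltr_pwDl// mulr_ge0 ?sqr_ge0.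
rewrite /norm2 /push_inside.
rewrite (eq_bigr (fun j => (X j ^+ 2 + e ^+ 2) / (1 + d.+1%:R * e ^+ 2))); last first.
  by move=> j _; rewrite sqr_sqrtr// divr_ge0 ?(ltW D0)// addr_ge0// sqr_ge0.
rewrite -mulr_suml big_split/= sumr_const card_ord -/(norm2 X) X1.
by rewrite -[e ^+ 2 *+ _]mulr_natl divff// gt_eqF.
Qed.

(** Closeness of Y to X makes 1 - ⟨X,Y⟩ at most [cos_gap] th^2/4. Shrinking Y_j by the relative
    amount m q_j costs at most m th^2 in the inner product with X, because X_j and Y_j are at most
    X_j + th. The total loss stays below [cos_gap] th^2 ≤ 1 - cos th, so the shrunk points remain in
    the cap. *)
Lemma VBk_cap_ge : exists2 c : R, 0 < c &
  forall (x y : 'I_d -> R) (th e : R), Tsimplex d x -> Bball d y ->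
  0 < th -> th <= pi -> 0 < e ->
  e = cos_gap / (4 * d.+1%:R) * th ->
  (forall j, 0 <= Yof y j) ->
  (forall j, `|Yof y j - sphere_lift x j| <= 2 * e) ->
  ((c * \prod_j cap_ratio (sphere_lift x j) th `^ kappa j)%:E <=
   VBk kappa (fun w => (\1_(ecap (fun i => Num.sqrt (x i)) th) w)%:E) (Yof y))%E.
Proof.
have [c c0 Hc] := @Vk_cap_ge R d.+1 kappa kappa0.
have g0 := @cos_gap_gt0 R; have g8 := @cos_gap_le R.
pose M : R := d.+1%:R; have M1 : 1 <= M by rewrite ler1n.
have M0 : 0 < M by lra.
(* Chosen so that the M coordinate losses m th^2 add up to [cos_gap] th^2/2. *)
pose m := @cos_gap R / (2 * M).
have m0 : 0 < m by rewrite divr_gt0// mulr_gt0.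
have m1 : m <= 1 by rewrite ler_pdivrMr; lra.
exists (c / 2 * \prod_j m `^ kappa j).
  by rewrite !mulr_gt0 ?invr_gt0//; apply: prodr_gt0 => j _; rewrite powR_gt0.
move=> x y th e Tx By th0 thp e0 eE Y0 YX.
set X := sphere_lift x in YX *; set Y := Yof y in Y0 YX *.
have X0 : forall j, 0 <= X j by move=> j; exact: sphere_lift_ge0.
have q0 j : 0 < cap_ratio (X j) th by exact: cap_ratio_gt0.
have X1 : norm2 X = 1 by exact: norm2_sphere_lift.
have Y1 : norm2 Y = 1 by exact: norm2_Yof.
have eM : M * e = cos_gap / 4 * th by rewrite eE -/M; field; rewrite gt_eqF.
have eth : 2 * e <= th.
  rewrite eE -/M mulrA ler_piMl ?(ltW th0)// mulrA ler_pdivrMr; lra.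
have V : ((c * \prod_j (m * cap_ratio (X j) th) `^ kappa j)%:E <=
   Vk kappa (fun w => (\1_(ecap (fun i => Num.sqrt (x i)) th) w)%:E) Y)%E.
  apply: Hc => // u uY1 uY2.
  have u0 j : 0 <= u j.
    apply: le_trans (uY2 j); rewrite mulr_ge0// subr_ge0 mulr_ile1//.
    + exact: ltW.
    + exact: ltW.
    + exact: cap_ratio_le1.
  rewrite lee_fin indicE mem_set//; split; last (split; last exact: u0); last first.
    rewrite -inner_Yof -/(sphere_lift x) -/X.
    have H1 : inner X Y - inner X u <= cos_gap / 2 * th ^+ 2.
      rewrite /inner -sumrB; apply: (@le_trans _ _ (\sum_(j < d.+1) (m * th ^+ 2))).
        apply: ler_sum => j _; rewrite -mulrBr.
        have h : Y j - u j <= Y j * (m * cap_ratio (X j) th) by have := uY2 j; lra.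
        apply: (@le_trans _ _ (X j * (Y j * (m * cap_ratio (X j) th)))).
          by rewrite ler_wpM2l.
        have -> : X j * (Y j * (m * cap_ratio (X j) th)) =
          m * (X j * Y j * cap_ratio (X j) th) by ring.
        rewrite ler_wpM2l ?(ltW m0)// /cap_ratio expr_div_n mulrA.
        have Xth : 0 < X j + th by have := X0 j; lra.
        rewrite ler_pdivrMr ?exprn_gt0// mulrC ler_wpM2l ?sqr_ge0// expr2.
        by apply: ler_pM => //; have := YX j; rewrite ?ler_norml; lra.
      rewrite sumr_const card_ord -mulr_natl -/M le_eqVlt; apply/orP; left.
      by apply/eqP; rewrite /m; field; rewrite gt_eqF.
    have H2 : 2 - 2 * inner X Y <= M * (2 * e) ^+ 2.
      rewrite -norm2B_unit//; apply: (@le_trans _ _ (\sum_(j < d.+1) (2 * e) ^+ 2)).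
        apply: ler_sum => j _; rewrite -(@real_normK _ (X j - Y j)) ?num_real//.
        by rewrite lerXn2r ?nnegrE//; [lra|rewrite distrC].
      by rewrite sumr_const card_ord -[leLHS]mulr_natl.
    have H3 : M * (2 * e) ^+ 2 <= cos_gap / 2 * th ^+ 2.
      have -> : M * (2 * e) ^+ 2 = (M * e) * (2 * (2 * e)) by ring.
      rewrite eM -mulrA [leRHS](_ : _ = cos_gap / 4 * (th * (2 * th))); last by field.
      rewrite ler_wpM2l//; first lra.
      by rewrite ler_wpM2l ?(ltW th0)//; lra.
    have := mulr_ge0 (ltW g0) (sqr_ge0 th).
    have := one_sub_cos_ge (ltW th0) thp; lra.
  rewrite -Y1; apply: ler_sum => j _; rewrite lerXn2r ?nnegrE//.
  exact: le_trans (ler_norm _) (uY1 j).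
have -> : c / 2 * \prod_j m `^ kappa j * \prod_j cap_ratio (X j) th `^ kappa j =
    c * \prod_j (m * cap_ratio (X j) th) `^ kappa j * 2^-1.
  have -> : \prod_j (m * cap_ratio (X j) th) `^ kappa j =
      \prod_j m `^ kappa j * \prod_j cap_ratio (X j) th `^ kappa j.
    by rewrite -big_split; apply: eq_bigr => j _; rewrite powRM// ltW.
  by ring.
(* The term of V^B at the reflected point is dropped, at the cost of the factor 1/2. *)
rewrite EFinM lee_wpmul2r ?lee_fin ?invr_ge0//.
by apply: (le_trans V); rewrite leeDl// Vk_ge0.
Qed.

(** The lift X may lie on the boundary of the positive orthant, so it is first pushed inside to a
    unit vector A with A_j ≥ (X_j+e)/2. For y in the window about A, every Y_j is at least a
    multiple of X_j + th, so W^B supplies ∏ (X_j+th)^(2κ_j) and a factor (1-‖y‖^2)^(-1/2). The first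
    product cancels the denominators of the q_j^κ_j from [VBk_cap_ge], and the window has mass of
    order th^d by [intd_window_ge]. *)
Lemma MB_denominator_ge : exists2 c : R, 0 < c &
  forall (x : 'I_d -> R) (th : R), Tsimplex d x -> 0 < th -> th <= pi ->
  ((c * th ^+ d * \prod_j th `^ (2 * kappa j))%:E <=
   intd (fun y => (\1_(@Bball R d) y)%:E *
      VBk kappa (fun w => (\1_(ecap (fun i => Num.sqrt (x i)) th) w)%:E) (Yof y) *
      (WB kappa y)%:E))%E.
Proof.
have [c c0 Hc] := VBk_cap_ge.
have g0 := @cos_gap_gt0 R; have g8 := @cos_gap_le R.
pose M : R := d.+1%:R; have M1 : 1 <= M by rewrite ler1n.
have M0 : 0 < M by lra.
pose eta := @cos_gap R / (4 * M).
have eta0 : 0 < eta by rewrite divr_gt0// mulr_gt0.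
have e40 : 0 < eta / 4 by rewrite divr_gt0.
have eta1 : eta <= 1 by rewrite ler_pdivrMr; lra.
pose c1 := c * \prod_j (eta / 4) `^ (2 * kappa j).
have c10 : 0 < c1.
  by rewrite mulr_gt0//; apply: prodr_gt0 => j _; rewrite powR_gt0// divr_gt0.
exists (c1 * (\prod_(j < d) 16 ^- j.+1 * (eta / 4) ^+ d)).
  rewrite mulr_gt0// mulr_gt0//; last by rewrite exprn_gt0// divr_gt0.
  by apply: prodr_gt0 => j _; rewrite invr_gt0 exprn_gt0.
move=> x th Tx th0 thp.
(* This is the e of [VBk_cap_ge]. The window half-width r = e/4 keeps Y within 2e of X and leaves
   Y_j ≥ X_j/2 + e/4. *)
pose e := eta * th; have e0 : 0 < e by rewrite mulr_gt0.
pose r := e / 4; have r0 : 0 < r by rewrite divr_gt0.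
have p4 : pi <= 4 :> R by have [/andP[_ ?] _] := @pihalf_02_cos_pihalf R; lra.
have Me : M * e <= 1.
  have -> : M * e = cos_gap / 4 * th by rewrite /e /eta; field; rewrite gt_eqF.
  have : @cos_gap R * th <= 8^-1 * 4 by apply: ler_pM; lra.
  lra.
set X := sphere_lift x.
have X0 j : 0 <= X j by exact: sphere_lift_ge0.
have X1 : norm2 X = 1 by exact: norm2_sphere_lift.
have Xle1 j : X j <= 1.
  rewrite -(@ler_pXn2r _ 2) ?nnegrE// expr1n -X1 /norm2 (bigD1 j)//= lerDl.
  by apply: sumr_ge0 => i _; exact: sqr_ge0.
pose A j := push_inside M e (X j).
have A1 j : (X j + e) / 2 <= A j by have [] := push_insideP M1 e0 Me (X0 j) (Xle1 j).
have A2 j : `|A j - X j| <= e by have [] := push_insideP M1 e0 Me (X0 j) (Xle1 j).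
have rA j : r <= A j by apply: le_trans (A1 j); have := X0 j; rewrite /r; lra.
have sA : \sum_(i < d) A (lift ord_max i) ^+ 2 + A ord_max ^+ 2 = 1.
  by rewrite -(sum_push_inside e X1) /norm2 big_ord_lift_max.
have H := intd_window_ge r0 (fun i => rA (lift ord_max i)) (rA ord_max) sA.
pose P := \prod_j th `^ (2 * kappa j).
have P0 : 0 <= P by apply: prodr_ge0 => j _; exact: powR_ge0.
apply: (@le_trans _ _ ((c1 * P)%:E * (\prod_(j < d) 16 ^- j.+1 * r ^+ d)%:E)%E).
  rewrite -EFinM lee_fin le_eqVlt; apply/orP; left; apply/eqP.
  have -> : r = eta / 4 * th by rewrite /r /e; ring.
  rewrite [(eta / 4 * th) ^+ d]exprMn -/P.
  by move: ((eta / 4) ^+ d) (th ^+ d) => a b; ring.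
have c1P0 : 0 <= c1 * P by rewrite mulr_ge0// ltW.
apply: (le_trans (lee_wpmul2l _ H)); first by rewrite lee_fin.
have W0 y : 0 <= WB kappa y.
  by rewrite mulr_ge0 ?powR_ge0//; apply: prodr_ge0 => i _; exact: powR_ge0.
have win0 y : 0 <= \prod_(i < d) \1_(`[A (lift ord_max i) - r, A (lift ord_max i) + r]%classic : set R) (y i) *
   sqrt_window (A ord_max) r (1 - norm2 y).
  by rewrite mulr_ge0 ?sqrt_window_ge0//; apply: prodr_ge0.
rewrite -intdZl//.
apply: le_intd => y; first by rewrite mule_ge0// lee_fin.
have ge0 : (0 <= (\1_(@Bball R d) y)%:E *
      VBk kappa (fun w => (\1_(ecap (fun i => Num.sqrt (x i)) th) w)%:E) (Yof y) *
      (WB kappa y)%:E)%E.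
  apply: mule_ge0; last by rewrite lee_fin.
  by apply: mule_ge0; [rewrite lee_fin|apply: VBk_ge0 => u; rewrite lee_fin].
have [yA|/existsNP[i yA]] := pselect (forall i : 'I_d,
    (`[A (lift ord_max i) - r, A (lift ord_max i) + r]%classic : set R) (y i)); last first.
  rewrite (bigD1 i)//= indicE memNset// !mul0r mule0.
  exact: ge0.
rewrite big1 ?mul1r; last by move=> i _; rewrite indicE mem_set.
rewrite sqrt_windowE; case: ifPn => [/andP[v0 yb]|_]; last by rewrite mule0.
set v := 1 - norm2 y in v0 yb *.
have By : Bball d y by rewrite /Bball/=; move: v0; rewrite /v; lra.
have YA j : `|Yof y j - A j| <= r.
  case: (unliftP ord_max j) => [i ->|->]; last by rewrite /Yof ext_max.
  by rewrite /Yof ext_lift ler_distl; have := yA i; rewrite /= in_itv.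
have YX j : `|Yof y j - X j| <= 2 * e.
  by have := YA j; have := A2 j; rewrite !ler_norml /r; lra.
have Yge j : eta / 4 * (X j + th) <= Yof y j.
  have h : eta * X j <= X j by rewrite ler_piMl.
  by have := YA j; have := A1 j; have := X0 j; rewrite !ler_norml /r /e; lra.
have Y0 j : 0 <= Yof y j.
  by apply: le_trans (Yge j); apply: mulr_ge0; [exact: ltW e40|rewrite addr_ge0// ltW].
have V := Hc x y th e Tx By th0 thp e0 erefl Y0 YX.
rewrite indicE mem_set// mul1e.
(* The last coordinate of Y is √v, so splitting v^(κ-1/2) makes the weight symmetric in all d+1
   coordinates, up to the density v^(-1/2) of the window. *)
have EW : WB kappa y = \prod_j Yof y j `^ (2 * kappa j) * v `^ (2^-1 - 1).
  rewrite /WB big_ord_lift_max/= -mulrA; congr (_ * _).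
    apply: eq_bigr => i _; rewrite /Yof ext_lift ger0_norm//.
    by have := Y0 (lift ord_max i); rewrite /Yof ext_lift.
  rewrite -/v /Yof ext_max -/v powRrM powR_mulrn ?sqrtr_ge0// sqr_sqrtr ?(ltW v0)//.
  rewrite -powRD; last by rewrite (gt_eqF v0) implybT.
  by congr powR; field.
apply: (@le_trans _ _ ((c * \prod_j cap_ratio (X j) th `^ kappa j)%:E *
   (WB kappa y)%:E)%E); last by rewrite lee_wpmul2r ?lee_fin.
rewrite -!EFinM lee_fin EW mulrA ler_wpM2r ?powR_ge0//.
have -> : c1 * P = c * \prod_j ((eta / 4) `^ (2 * kappa j) * th `^ (2 * kappa j)).
  by rewrite big_split/= mulrA.
rewrite -[leRHS]mulrA -big_split/= ler_wpM2l ?(ltW c0)//.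
apply: ler_prod => j _; rewrite mulr_ge0 ?powR_ge0//=.
have Xth : 0 < X j + th by have := X0 j; lra.
rewrite cap_ratio_powR// -[leRHS]mulrA [leLHS]mulrC ler_wpM2l ?powR_ge0//.
rewrite ler_pdivlMl ?powR_gt0// mulrC -powRM ?(ltW e40) ?(ltW Xth)//.
apply: ge0_ler_powR; rewrite ?nnegrE//; first by rewrite mulr_ge0.
by rewrite mulr_ge0// ltW.
Qed.

End DenominatorLowerBound.

Theorem theorem5p3 (R : realType) (d : nat) (kappa : 'I_d.+1 -> R) :
  (0 < d)%N -> (forall i, 0 <= kappa i) ->
  exists c : R, forall f : ('I_d -> R) -> R, L1T kappa f ->
    forall x : 'I_d -> R, Tsimplex d x ->
      (calMT kappa f x <= c%:E * MT kappa f x)%E.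
Proof.
move=> _ k0.
have [C1 C10 HN] := MB_numerator_le k0.
have [c3 c30 HD] := MB_denominator_ge k0.
pose C2 : R := 8 ^+ d * (d.+1)`!%:R.
have C20 : 0 < C2 by rewrite mulr_gt0 ?exprn_gt0 ?ltr0n ?fact_gt0.
exists (C1 * C2 / c3) => f _ x Tx.
have C0 : 0 <= C1 * C2 / c3 by rewrite ltW// divr_gt0// mulr_gt0.
apply: ge_ereal_sup => _ [th /andP[th0 thp] ->].
pose A := @Tsimplex R d `&` [set y | dT x y <= th].
pose NT := intd (fun y => (\1_A y)%:E * (`|f y| * WT kappa y)%:E)%E.
pose DT := intd (fun y => (\1_A y)%:E * (WT kappa y)%:E)%E.
suff H : forall NB DB : \bar R,
    (NB <= (C1 * \prod_j cap_ratio (sphere_lift x j) th `^ kappa j)%:E * NT)%E ->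
    (DB <= (C1 * \prod_j cap_ratio (sphere_lift x j) th `^ kappa j)%:E * DT)%E ->
    ((c3 * th ^+ d * \prod_j th `^ (2 * kappa j))%:E <= DB)%E ->
    (eratio NB DB <= (C1 * C2 / c3)%:E * eratio NT DT)%E.
  apply: (@le_trans _ _ ((C1 * C2 / c3)%:E * eratio NT DT)%E).
    apply: H; [exact: HN| |exact: HD].
    (* The numerator bound for f = 1 compares the two denominators. *)
    have := HN (fun _ => 1) x th Tx th0 thp.
    under eq_fun do rewrite normr1 mule1.
    by under [X in (_ <= _ * intd X)%E]eq_fun do rewrite normr1 mul1r.
  rewrite lee_wpmul2l ?lee_fin//; apply: ereal_sup_ubound.
  by exists th => //; rewrite th0.
have W0 y : 0 <= WT kappa y.
  by rewrite mulr_ge0 ?powR_ge0//; apply: prodr_ge0 => i _; exact: powR_ge0.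
have NT0 : (0 <= NT)%E.
  by apply: intd_ge0 => y; rewrite mule_ge0 ?lee_fin// mulr_ge0.
have DT0 : (0 <= DT)%E by apply: intd_ge0 => y; rewrite mule_ge0 ?lee_fin.
have := MT_denominator_le k0 Tx th0 thp; rewrite -/A -/DT -/C2.
set K := C1 * _; set Q := \prod_j _; set P := \prod_j _ => DTle NB DB NBle DBle DBge.
have X0 j : 0 < sphere_lift x j + th by have := sphere_lift_ge0 x j; lra.
have P0 : 0 < P by apply: prodr_gt0 => j _; rewrite powR_gt0.
have Q0 : 0 < Q by apply: prodr_gt0 => j _; rewrite powR_gt0.
have KE : K = C1 * (P / Q).
  rewrite /K /P /Q -prodf_div; congr (_ * _); apply: eq_bigr => j _.
  by rewrite cap_ratio_powR// sphere_lift_ge0.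
have K0 : 0 <= K by rewrite KE ltW// mulr_gt0// divr_gt0.
have thd : 0 < th ^+ d by rewrite exprn_gt0.
(* For an infinite denominator [fine] gives 0, its inverse is 0, and the left quotient is 0. *)
case: DB DBle DBge => [db|_ _|_]; last 2 first.
- rewrite /eratio/= invr0 mule0; apply: mule_ge0; first by rewrite lee_fin.
  by apply: mule_ge0 => //; rewrite lee_fin invr_ge0 fine_ge0.
- by rewrite leNgt ltNyr.
rewrite /eratio; move: DT DT0 DTle => [dt||//]; last by rewrite leye_eq.
rewrite !lee_fin /= => dt0 dtle dble dbge.
have db0 : 0 < db by apply: lt_le_trans dbge; rewrite !mulr_gt0.
(* From 0 < db ≤ K dt: the quotient on the simplex is a genuine one, not the default value of
   division by 0. *)
have dtp : 0 < dt.
  rewrite lt_neqAle dt0 andbT; apply/eqP => dtE.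
  by move: dble; rewrite -dtE mulr0; lra.
apply: (@le_trans _ _ ((K / db)%:E * NT)%E).
  rewrite EFinM -muleA [X in (_ <= _ * X)%E]muleC muleA.
  by rewrite lee_wpmul2r// lee_fin invr_ge0 ltW.
rewrite [X in (_ <= _ * X)%E]muleC muleA -EFinM lee_wpmul2r// lee_fin.
(* What remains is K dt ≤ (C1 C2 / c3) db. It follows from dt ≤ C2 th^d Q and c3 th^d P ≤ db, since
   K = C1 P/Q. *)
rewrite ler_pdivrMr// mulrAC ler_pdivlMr//.
apply: (@le_trans _ _ (K * (C2 * th ^+ d * Q))); first by rewrite ler_wpM2l.
have -> : K * (C2 * th ^+ d * Q) = C1 * C2 / c3 * (c3 * th ^+ d * P).
  by rewrite KE; field; rewrite !gt_eqF.
by rewrite ler_wpM2l.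
Qed.
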